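(* Let $M$ be a compact smooth Riemannian manifold and $f:M\to M$ a $C^1$ diffeomorphism. Let $K\in\mathbb{N}$, $\zeta>\bar\zeta>0$ and $k\ge1$, and let $W^{cs}_\epsilon(x)$, $W^{cu}_\epsilon(x)$ be the (fixed) local center stable and center unstable manifolds of size $\epsilon$ of points $x\in\Delta=\overline{\bigcup_{l\in\mathbb{Z}}f^l(\Lambda^{\#}_k(K,\zeta))}$. Then there exist $\epsilon_0=\epsilon_0(K,\zeta,\bar\zeta,k)>0$ and $\bar C=\bar C(K,k,\zeta,\bar\zeta)\ge1$ such that for any $0<\epsilon\le\epsilon_0$ and all $x\in\Lambda^{\#}_k(K,\zeta)$, $$\mathrm{diam}(f^nW^{cs}_\epsilon(x))\to0\quad\text{and}\quad\mathrm{diam}(f^{-n}W^{cu}_\epsilon(x))\to0\qquad(n\to\infty),$$ i.e. the center stable manifold of size $\epsilon$ is in fact a stable manifold and the center unstable manifold of size $\epsilon$ is in fact an unstable manifold. Moreover, for all $n\ge1$, $$\frac{\mathrm{diam}(f^nW^{cs}_\epsilon(x))}{\mathrm{diam}(W^{cs}_\epsilon(x))}\le\bar Ce^{-\bar\zeta n}\qquad\text{and}\qquad\frac{\mathrm{diam}(f^{-n}W^{cu}_\epsilon(x))}{\mathrm{diam}(W^{cu}_\epsilon(x))}\le\bar Ce^{-\bar\zeta n}.$$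
   Context: For an invertible linear map $A$, $m(A)=\|A^{-1}\|^{-1}$. For $K,k\ge1$ and $\zeta>0$, $\Lambda^{\#}_k(K,\zeta)$ is the set of $x\in M$ for which there is a splitting $T_xM=E(x)\oplus F(x)$, carried along the orbit of $x$ by $Df$ (i.e. $Df(E(x))=E(f(x))$, $Df(F(x))=F(f(x))$), such that (a) $\frac{\log\|Df^r|_{E(x)}\|+\sum_{j=0}^{l-1}\log\|Df^K|_{E(f^{jK+r}(x))}\|}{lK+r}\le-\zeta$ for all $l\ge k$, $0\le r\le K-1$; (b) $\frac{\log m(Df^r|_{F(f^{-lK-r}(x))})+\sum_{j=-l}^{-1}\log m(Df^K|_{F(f^{jK}(x))})}{lK+r}\ge\zeta$ for all $l\ge k$, $0\le r\le K-1$; (c) $\frac1{kK+r}\log\frac{\|Df^{kK+r}|_{E(x)}\|}{m(Df^{kK+r}|_{F(x)})}\le-2\zeta$ for all $0\le r\le K-1$, and $\frac1K\log\frac{\|Df^K|_{E(f^l(x))}\|}{m(Df^K|_{F(f^l(x))})}\le-2\zeta$ for all $l\ge kK$; (d) $\frac1{kK}\log\frac{\|Df^{kK}|_{E(f^l(x))}\|}{m(Df^{kK}|_{F(f^l(x))})}\le-2\zeta$ for all $l\in\mathbb{Z}$. By (d) the splitting $E\oplus F$ extends to a (continuous) dominated splitting on the compact invariant set $\Delta=\overline{\bigcup_{l\in\mathbb{Z}}f^l(\Lambda^{\#}_k(K,\zeta))}$, i.e. there are $C>0$, $0<\lambda<1$ with $\|Df^n|_{E(x)}\|/m(Df^n|_{F(x)})\le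 C\lambda^n$ for $x\in\Delta$, $n\ge1$. Center manifolds (Hirsch-Pugh-Shub): for such a dominated splitting one fixes families of $C^1$ embeddings $\theta^{cs}(x)$, $\theta^{cu}(x)$ into $M$ ($x\in\Delta$) of the open unit balls of dimension $\dim E(x)$, resp. $\dim F(x)$, depending continuously on $x$ in the $C^1$ topology, such that, with $W^{cs}_\epsilon(x)=\theta^{cs}(x)(I_\epsilon)$ and $W^{cu}_\epsilon(x)=\theta^{cu}(x)(I_\epsilon)$ where $I_\epsilon$ is the open $\epsilon$-ball about $0$: $\theta^{cs}(x)(0)=\theta^{cu}(x)(0)=x$; $T_xW^{cs}_\epsilon(x)=E(x)$ and $T_xW^{cu}_\epsilon(x)=F(x)$; and for each $0<\epsilon_1<1$ there is $0<\epsilon_2<1$ with $f(W^{cs}_{\epsilon_2}(x))\subseteq W^{cs}_{\epsilon_1}(f(x))$ and $f^{-1}(W^{cu}_{\epsilon_2}(x))\subseteq W^{cu}_{\epsilon_1}(f^{-1}(x))$ for all $x\in\Delta$. These families are fixed once and for all; the constants may depend on $f$ and on this choice. *)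

(* Defs.v *)
From HB Require Import structures.
From mathcomp Require Import all_boot all_order all_algebra.
From mathcomp Require Import all_classical all_reals all_analysis.

Set Implicit Arguments.
Unset Strict Implicit.
Unset Printing Implicit Defensive.

Import Order.TTheory GRing.Theory Num.Theory.
Import numFieldNormedType.Exports.

Local Open Scope classical_set_scope.
Local Open Scope ring_scope.

(* C^n maps on an open subset U of a finite-dimensional space V; for n >= 1 the
   derivatives in all fixed directions are required to be C^(n-1). *)
Fixpoint Cn (R : realType) (V W : normedModType R) (n : nat)
    (U : set V) (h : V -> W) : Prop :=
  match n with
  | 0%N => forall p, U p -> {for p, continuous h}
  | n'.+1 => (forall p, U p -> differentiable h p) /\
             forall v, Cn n' U (fun p => 'd h p v)
  end.

Definition Cinfty (R : realType) (V W : normedModType R)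
  (U : set V) (h : V -> W) : Prop := forall n, Cn n U h.

(* A smooth structure is given by an atlas with one preferred chart around each
   point x: [chart x], with domain [dom x] and inverse [param x].  Any smooth
   atlas yields one of this form, by choosing a chart around each point.
   Second countability is automatic for the compact manifolds considered. *)
Record manifold (R : realType) (d : nat) := Manifold {
  carrier :> topologicalType;
  dom : carrier -> set carrier;
  chart : carrier -> carrier -> 'rV[R]_d;
  param : carrier -> 'rV[R]_d -> carrier;
  manifold_hausdorff : hausdorff_space carrier;
  dom_open : forall x, open (dom x);
  dom_center : forall x, dom x x;
  codom_open : forall x, open (chart x @` dom x);
  chartK : forall x y, dom x y -> param x (chart x y) = y;
  chart_continuous : forall x y, dom x y -> {for y, continuous (chart x)};
  param_continuous : forall x p, (chart x @` dom x) p ->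
    {for p, continuous (param x)};
  transition_smooth : forall x y,
    Cinfty (chart x @` (dom x `&` dom y)) (chart y \o param x)
}.

Arguments dom {R d m}.
Arguments chart {R d m}.
Arguments param {R d m}.

Section Manifold.
Variables (R : realType) (d : nat) (M : manifold R d).
Local Notation vec := 'rV[R]_d.

(* The tangent space at every point x is represented by 'rV[R]_d, a tangent
   vector being given by its coordinates in the preferred chart [chart x]. *)

(* The tangent map of h : V -> M at p, with values in the tangent space at h p *)
Definition tangent (V : normedModType R) (h : V -> M) (p : V) : V -> vec :=
  'd (chart (h p) \o h) p.

(* The tangent map of f : M -> M at x, from the tangent space at x to the one
   at f x *)
Definition D (f : M -> M) (x : M) : vec -> vec :=
  tangent (f \o param x) (chart x x).

(* Coordinates in the chart around x0 of the tangent vectors at y *)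
Definition tcoord (x0 y : M) : vec -> vec :=
  'd (chart x0 \o param y) (chart y y).

Definition C1into (V : normedModType R) (U : set V) (h : V -> M) : Prop :=
  (forall p, U p -> {for p, continuous h}) /\
  forall y, Cn 1 (U `&` h @^-1` dom y) (chart y \o h).

Definition C1map (f : M -> M) : Prop :=
  forall x, C1into (chart x @` dom x) (f \o param x).

Definition C1diffeo (f finv : M -> M) : Prop :=
  [/\ cancel f finv, cancel finv f, C1map f & C1map finv].

Record riemannian := Riemannian {
  gram : M -> 'M[R]_d;
  gram_sym : forall x, (gram x)^T = gram x;
  gram_pos : forall x (v : vec), v != 0 -> 0 < (v *m gram x *m v^T) 0 0;
  gram_smooth : forall (x : M) (u v : vec),
    Cinfty (chart x @` dom x) (fun p =>
      (tangent (param x) p u *m gram (param x p) *m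
       (tangent (param x) p v)^T) 0 0 : R)
}.

Variable G : riemannian.

Definition rnorm (x : M) (v : vec) : R := Num.sqrt ((v *m gram G x *m v^T) 0 0).

Definition curve_length (c : R -> M) : \bar R :=
  \int[lebesgue_measure]_(t in `[0, 1]%classic)
     (rnorm (c t) (tangent c t 1))%:E.

Definition C1curve (c : R -> M) : Prop :=
  exists U : set R, [/\ open U, `[0, 1]%classic `<=` U & C1into U c].

Definition rdist (x y : M) : \bar R :=
  ereal_inf [set curve_length c | c in
    [set c : R -> M | [/\ C1curve c, c 0 = x & c 1 = y]]].

Definition diam (A : set M) : \bar R :=
  ereal_sup [set rdist p.1 p.2 | p in A `*` A].

(* For the zero subspace, [opnorm] is 0 and [conorm] is +oo. *)
Definition opnorm (x y : M) (A : vec -> vec) (E : {vspace vec}) : \bar R :=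
  ereal_sup [set (rnorm y (A v))%:E | v in
    [set v | v \in E /\ rnorm x v <= 1]].

(* The inverse of the norm of the inverse of A : F -> A(F) *)
Definition conorm (x y : M) (A : vec -> vec) (F : {vspace vec}) : \bar R :=
  ((ereal_sup [set (rnorm x v)%:E | v in
    [set v | v \in F /\ (rnorm y (A v) <= 1)%R]])^-1)%E.

Definition dnorm (f : M -> M) (n : nat) (E : M -> {vspace vec}) (x : M) :=
  opnorm x (iter n f x) (D (iter n f) x) (E x).

Definition dconorm (f : M -> M) (n : nat) (F : M -> {vspace vec}) (x : M) :=
  conorm x (iter n f x) (D (iter n f) x) (F x).

Definition iterz (f finv : M -> M) (l : int) : M -> M :=
  match l with
  | Posz n => iter n f
  | Negz n => iter n.+1 finv
  end.

Definition splitting_at (E F : M -> {vspace vec}) (x : M) : Prop :=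
  (E x + F x)%VS = fullv /\ (E x :&: F x)%VS = 0%VS.

Definition invariant_at (f : M -> M) (E : M -> {vspace vec}) (x : M) : Prop :=
  (linfun (D f x) @: E x)%VS = E (f x).

Section Pesin.
Variables (f finv : M -> M) (K k : nat) (zeta : R) (E F : M -> {vspace vec}).
Local Notation fz := (iterz f finv).
Local Open Scope ereal_scope.

Definition orbit_splitting (x : M) : Prop := forall l : int,
  [/\ splitting_at E F (fz l x), invariant_at f E (fz l x) &
      invariant_at f F (fz l x)].

Definition cond_a (x : M) : Prop := forall l r : nat, (k <= l)%N -> (r < K)%N ->
  (lne (dnorm f r E x) +
   \sum_(0 <= j < l) lne (dnorm f K E (fz (j * K + r)%N%:Z x)))
  / ((l * K + r)%:R)%:E <= (- zeta)%:E.

(* The summation index j below is the opposite of the usual one, which ranges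
   over -l, ..., -1. *)
Definition cond_b (x : M) : Prop := forall l r : nat, (k <= l)%N -> (r < K)%N ->
  zeta%:E <=
  (lne (dconorm f r F (fz (- (l * K + r)%N%:Z)%R x)) +
   \sum_(1 <= j < l.+1) lne (dconorm f K F (fz (- (j * K)%N%:Z)%R x)))
  / ((l * K + r)%:R)%:E.

Definition dom_ratio (n : nat) (x : M) : \bar R :=
  lne (dnorm f n E x / dconorm f n F x) / (n%:R)%:E.

Definition cond_c (x : M) : Prop :=
  (forall r : nat, (r < K)%N ->
     dom_ratio (k * K + r) x <= (- (2 * zeta))%:E) /\
  (forall l : nat, (k * K <= l)%N ->
     dom_ratio K (fz l%:Z x) <= (- (2 * zeta))%:E).

Definition cond_d (x : M) : Prop := forall l : int,
  dom_ratio (k * K) (fz l x) <= (- (2 * zeta))%:E.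

Definition pesin_splitting (x : M) : Prop :=
  [/\ orbit_splitting x, cond_a x, cond_b x, cond_c x & cond_d x].

End Pesin.

(* The block Lambda^#_k(K, zeta) *)
Definition Lambda (f finv : M -> M) (K k : nat) (zeta : R) : set M :=
  [set x | exists E F, pesin_splitting f finv K k zeta E F x].

Definition Delta (f finv : M -> M) (K k : nat) (zeta : R) : set M :=
  closure (\bigcup_(l in [set: int]) (iterz f finv l @` Lambda f finv K k zeta)).

(* For each x0 in X, as y tends to x0 in X, E y has (in the chart around x0) a
   basis converging to a basis of E x0. *)
Definition continuous_subbundle (X : set M) (E : M -> {vspace vec}) : Prop :=
  forall x0, X x0 -> exists (m : nat) (b : M -> m.-tuple vec),
    (forall i : 'I_m,
       tnth (b y) i @[y --> within X (nbhs x0)] --> tnth (b x0) i) /\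
    (\forall y \near within X (nbhs x0),
       dom x0 y /\ basis_of (linfun (tcoord x0 y) @: E y)%VS (b y)).

Definition dominated_splitting (f : M -> M) (X : set M)
    (E F : M -> {vspace vec}) : Prop :=
  [/\ forall x, X x -> [/\ splitting_at E F x, invariant_at f E x &
                           invariant_at f F x],
      continuous_subbundle X E, continuous_subbundle X F &
      exists C lambda : R, [/\ 0 < C, 0 < lambda < 1 &
        forall x n, X x -> (0 < n)%N ->
          (dnorm f n E x / dconorm f n F x <= (C * lambda ^+ n)%:E)%E]].

(* The open Euclidean ball of radius e in R^m (the library norm on matrices is
   the sup norm). *)
Definition eball (m : nat) (e : R) : set 'rV[R]_m :=
  [set v | Num.sqrt (\sum_(i < m) v 0 i ^+ 2) < e].
Arguments eball m e : clear implicits.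

Definition C1embedding (m : nat) (th : 'rV[R]_m -> M) : Prop :=
  [/\ C1into (eball m 1) th,
      forall v, eball m 1 v -> injective (tangent th v),
      {in eball m 1 &, injective th} &
      (* the inverse is continuous on the image *)
      forall v, eball m 1 v -> forall A, nbhs v A -> exists2 B, nbhs (th v) B &
        forall w, eball m 1 w -> B (th w) -> A w].

(* Continuity of y |-> th y on X at x, for the C^1 topology (uniform convergence
   in charts of maps and derivatives on compact subsets of the open ball). *)
Definition C1topology_continuous_at (m : nat) (X : set M)
    (th : M -> 'rV[R]_m -> M) (x : M) : Prop :=
  forall (z : M) (Q : set 'rV[R]_m) (eta : R),
    compact Q -> Q `<=` eball m 1 -> th x @` Q `<=` dom z -> 0 < eta ->
    \forall y \near within X (nbhs x), th y @` Q `<=` dom z /\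
      forall v, Q v -> `|chart z (th y v) - chart z (th x v)| < eta /\
        forall w, `|'d (chart z \o th y) v w - 'd (chart z \o th x) v w|
                  <= eta * `|w|.

(* The dimension of E x may vary with x: a family of discs is given in every
   dimension m, only the one with m = \dim (E x) being used at x. *)
Definition disc_family := forall m : nat, M -> 'rV[R]_m -> M.

(* The disc of size e at x: W^cs_e(x) or W^cu_e(x) *)
Definition disc (E : M -> {vspace vec}) (th : disc_family) (e : R) (x : M)
  : set M := th (\dim (E x)) x @` eball (\dim (E x)) e.

Definition tangent_disc_family (X : set M) (E : M -> {vspace vec})
    (th : disc_family) : Prop :=
  (forall x, X x ->
     [/\ C1embedding (th (\dim (E x)) x),
         th (\dim (E x)) x 0 = x &
         limg (linfun (tangent (th (\dim (E x)) x) 0)) = E x]) /\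
  (forall m x, X x -> \dim (E x) = m ->
     C1topology_continuous_at (X `&` [set y | \dim (E y) = m]) (th m) x).

Definition center_manifolds (f finv : M -> M) (X : set M)
    (E F : M -> {vspace vec}) (thcs thcu : disc_family) : Prop :=
  [/\ tangent_disc_family X E thcs, tangent_disc_family X F thcu &
      forall e1 : R, 0 < e1 < 1 -> exists2 e2 : R, 0 < e2 < 1 &
        forall x, X x ->
          f @` disc E thcs e2 x `<=` disc E thcs e1 (f x) /\
          finv @` disc F thcu e2 x `<=` disc F thcu e1 (finv x)].

End Manifold.

(* Main.v *)
Require Import Defs.
From HB Require Import structures.
From mathcomp Require Import all_boot all_order all_algebra.
From mathcomp Require Import all_classical all_reals all_analysis.
From mathcomp Require Import ring lra zify.

Set Implicit Arguments.
Unset Strict Implicit.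
Unset Printing Implicit Defensive.

Import Order.TTheory GRing.Theory Num.Theory.
Import numFieldNormedType.Exports.

Local Open Scope classical_set_scope.
Local Open Scope ring_scope.

(** The discs W^cs_e(x) are only almost invariant: f maps a smaller disc at y
    into a larger disc at f y.  The theorem says that, started at a point x of
    the block, small discs do not merely stay inside larger ones but shrink at
    the rate of the product of the norms of Df on E along the orbit of x, up to
    an arbitrarily small loss in the exponent.

    Everything is measured in the coordinates of the discs.  Let th_y be the
    disc at y in Delta, T_y its tangent map at 0, whose image is E(y), and
    |w|_y the Riemannian norm of T_y w ([disc_norm]).  Three facts carry the
    proof.

    - Let g = f^r, p = th_y u and q = th_y v near y, with g p = th_(g y) u' and
      g q = th_(g y) v'.  For every a > 1, if u, v, u', v' are small enough then
      |u' - v'|_(g y) <= a ||Dg|E(y)|| |u - v|_y.  Indeed the discs and g depend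
      continuously on y in the C^1 topology, so that in a chart around g y0 the
      map g o th_y is, for y near y0, C^1-close on a small ball to its
      linearization at 0 ([disc_linearize], by the mean value inequality);
      compactness of Delta makes the size uniform ([disc_step_uniform]).

    - On small discs the Riemannian distance between th_y u and th_y v is
      comparable to |u - v|_y, uniformly in y ([disc_metric_uniform]).  This
      rests on the comparison of the distance with the coordinate distance in a
      chart ([rdist_chart]): straight segments give the upper bound, and a curve
      that leaves the chart is already long, which gives the lower one.

    - Condition (a) decomposes every n >= kK into at most 2n steps of length at
      most K along which the norms of Df on E multiply to at most exp(- zeta n)
      ([contracts_forward]).  Condition (b) gives the same for the inverse of f
      on F, since the conorm of Df^r on F bounds the inverse of the norm of
      Df^(-r) on F ([contracts_backward]).

    Take a = exp((zeta - zetabar) / 2).  As long as the orbits of p and q stay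
    in discs of the size allowed by the first fact, composing the steps loses at
    most a^(2n) = exp((zeta - zetabar) n), whence
    |u_n - v_n| <= C exp(- zetabar n) |u - v| ([disc_orbit_estimate]).  With
    q = x this bound keeps u_n small, so that local invariance may be applied
    once more: by induction the orbit of a sufficiently small disc never leaves
    the discs ([disc_contraction]).  Along the orbit only differences of disc
    coordinates are compared, at the centers of the discs, so that neither cone
    fields nor tangent spaces at other points of the discs are involved.

    The theorem follows by applying this to f and E, then to the inverse of f
    and F.  The dimension of E is locally constant on Delta because the
    dimensions of E and F are both lower semicontinuous while their sum is
    constant ([splitting_dim_locally_constant]). *)

#[local] Opaque diff.

(** * Differential calculus at a point *)

Section Calculus.
Variable R : realType.

(** Differentiability is a local property; the values of a map outside a chart
    domain are arbitrary, so that identities between maps read in charts only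
    hold near a point. *)
Lemma near_eq_is_diff (V W : normedModType R) (f g : V -> W) (p : V) :
  (\forall q \near p, f q = g q) -> differentiable f p ->
  differentiable g p /\ 'd g p = 'd f p :> (V -> W).
Proof.
move=> fg df.
have fgp := nbhs_singleton fg.
have fo : g \o shift p = cst (g p) + 'd f p +o_ (0 : V) id.
  have /diff_locally/eqaddoP fo := df.
  apply/eqaddoP => e e0; have := fo e e0.
  have fg0 : \forall q \near (0 : V), f (q + p) = g (q + p).
    rewrite -[X in \forall q \near _, X q]/((fun q => f q = g q) \o shift p).
    by have := fg; rewrite (near_shift 0 p) /= subr0.
  apply: filter_app; move: fg0; apply: filterS => q /= fgq.
  by rewrite !fctE /= fgq fgp.
have dE : 'd g p = 'd f p :> (V -> W).
  by apply: diff_unique => //; exact: diff_continuous.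
split => //; apply/diff_locallyP; split; last by rewrite dE.
by rewrite dE; exact: diff_continuous.
Qed.

(** The chain rule for a map g which is a composite only near the point, the
    usual situation for changes of charts. *)
Lemma near_diff_comp (U V W : normedModType R) (h : U -> V) (k : V -> W)
    (g : U -> W) p y : h p = y -> (\forall q \near p, k (h q) = g q) ->
  differentiable h p -> differentiable k y ->
  forall v, 'd g p v = 'd k y ('d h p v).
Proof.
move=> <- gE dh dk v.
have [|_ ->] := @near_eq_is_diff _ _ (k \o h) g p gE.
  exact: differentiable_comp.
by rewrite (diff_comp dh dk).
Qed.

(** Continuity of the derivative at p is required in each fixed direction; on a
    finite-dimensional space this is continuity of the differential.  Together
    with differentiability near p it makes the class stable under composition
    while avoiding any reference to a domain. *)
Definition C1at (V W : normedModType R) (h : V -> W) (p : V) : Prop :=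
  (\forall q \near p, differentiable h q) /\
  forall v, {for p, continuous (fun q => 'd h q v)}.

Lemma C1at_diff (V W : normedModType R) (h : V -> W) (p : V) :
  C1at h p -> differentiable h p.
Proof. by case=> /nbhs_singleton. Qed.

Lemma near_eq_C1at (V W : normedModType R) (f g : V -> W) (p : V) :
  (\forall q \near p, f q = g q) -> C1at f p -> C1at g p.
Proof.
move=> /near_join fg [df cf].
have dfg : \forall q \near p,
    differentiable g q /\ 'd g q = 'd f q :> (V -> W).
  by near do apply: near_eq_is_diff.
split=> [|v]; first by apply: filterS dfg => q [].
have /nbhs_singleton [_ dp] := dfg.
rewrite /prop_for /continuous_at /= dp; apply: cvg_trans (cf v); apply: near_eq_cvg.
by apply: filterS dfg => q [_ ->].
Unshelve. all: by end_near. Qed.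

Lemma linear_rV_sum (W : normedModType R) m (A : {linear 'rV[R]_m -> W}) w :
  A w = \sum_i w 0 i *: A (delta_mx 0 i).
Proof.
by rewrite [in LHS](row_sum_delta w) linear_sum; apply: eq_bigr => i _; rewrite linearZ.
Qed.

Lemma coord_le_norm m (w : 'rV[R]_m) i : `|w 0 i| <= `|w|.
Proof.
by rewrite [leRHS]/Num.Def.normr/= mx_normrE; exact: (le_bigmax _ _ (0, i)).
Qed.

Lemma norm_le_coord m (w : 'rV[R]_m) c : 0 <= c ->
  (forall i, `|w 0 i| <= c) -> `|w| <= c.
Proof.
move=> c0 h; rewrite [leLHS]/Num.Def.normr/= mx_normrE; apply: bigmax_le => // -[i j] _.
by rewrite ord1.
Qed.

Lemma norm_lt_coord m (w : 'rV[R]_m) c : 0 < c ->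
  (forall i, `|w 0 i| < c) -> `|w| < c.
Proof.
move=> c0 h; rewrite [ltLHS]/Num.Def.normr/= mx_normrE; apply: bigmax_lt => // -[i j] _.
by rewrite ord1.
Qed.

(** The middle space is finite-dimensional: expanding 'd h p v in the standard
    basis reduces the continuity of the composite differential to continuity in
    the fixed directions of that basis. *)
Lemma C1at_comp (U W : normedModType R) n (h : U -> 'rV[R]_n)
    (k : 'rV[R]_n -> W) (p : U) :
  C1at h p -> C1at k (h p) -> C1at (k \o h) p.
Proof.
move=> [dh ch] [dk ck].
have dhp := nbhs_singleton dh.
have chp : {for p, continuous h} by exact: differentiable_continuous dhp.
have dkh : \forall q \near p, differentiable k (h q) by exact: (chp _ dk).
have dE : \forall q \near p, differentiable h q /\ differentiable k (h q).
  by near=> q; split; near: q.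
split=> [|v].
  by apply: filterS dE => q [dhq dkq]; exact: differentiable_comp.
rewrite /prop_for /continuous_at /=.
have -> : 'd (k \o h) p v = \sum_i ('d h p v) 0 i *: 'd k (h p) (delta_mx 0 i).
  rewrite diff_comp //=; last exact: nbhs_singleton dkh.
  exact: linear_rV_sum.
apply: (@cvg_trans _ ((\sum_i ('d h q v) 0 i *: 'd k (h q) (delta_mx 0 i)) @[q --> p])).
  apply: near_eq_cvg; apply: filterS dE => q [dhq dkq].
  by rewrite (diff_comp dhq dkq) /= -linear_rV_sum.
apply: cvg_big => [|i _]; first exact: add_continuous.
apply: cvgZ.
  exact: (@cvg_comp _ _ _ (fun q => 'd h q v) (fun N : 'rV_n => N 0 i) _ _ _ (ch v) (@coord_continuous _ _ _ 0 i _)).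
exact: (@cvg_comp _ _ _ h (fun q => 'd k q (delta_mx 0 i)) _ _ _ chp (ck _)).
Unshelve. all: by end_near. Qed.

Lemma Cn1_C1at (V W : normedModType R) (U : set V) (h : V -> W) p :
  nbhs p U -> Cn 1 U h -> C1at h p.
Proof.
move=> Up [dh ch]; split; first by apply: filterS Up => q /dh.
by move=> v; apply: ch; exact: nbhs_singleton Up.
Qed.

Lemma C1at_Cn1 (V W : normedModType R) (U : set V) (h : V -> W) :
  (forall p, U p -> C1at h p) -> Cn 1 U h.
Proof.
move=> H; split=> [p /H /C1at_diff//|v p /H [_]]; exact.
Qed.

Lemma linear_rV_dist_bound (W : normedModType R) m (A B : {linear 'rV[R]_m -> W})
    (eta : R) : 0 <= eta ->
  (forall i, `|A (delta_mx 0 i) - B (delta_mx 0 i)| <= eta / m.+1%:R) ->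
  forall w, `|A w - B w| <= eta * `|w|.
Proof.
move=> eta0 H w; rewrite (linear_rV_sum A) (linear_rV_sum B) -sumrB.
apply: le_trans (ler_norm_sum _ _ _) _.
apply: (@le_trans _ _ (\sum_(i < m) `|w| * (eta / m.+1%:R))).
  by apply: ler_sum => i _; rewrite -scalerBr normrZ ler_pM ?coord_le_norm.
rewrite sumr_const card_ord -[leLHS]mulr_natr -mulrA
  [leRHS]mulrC ler_wpM2l//.
rewrite mulrAC -mulrA -[leRHS]mulr1 ler_wpM2l// ler_pdivrMr// mul1r ler_nat.
exact: leqnSn.
Qed.

(** In finite dimension, continuity in the directions of the standard basis gives
    closeness of the differentials in operator norm. *)
Lemma C1at_near_op (W : normedModType R) m (h : 'rV[R]_m -> W) p (eta : R) :
  0 < eta -> C1at h p ->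
  \forall q \near p, differentiable h q /\
    forall w, `|'d h q w - 'd h p w| <= eta * `|w|.
Proof.
move=> eta0 [dh ch].
have e0 : 0 < eta / m.+1%:R by rewrite divr_gt0.
have Hi (i : 'I_m) : \forall q \near p,
    `|'d h q (delta_mx 0 i) - 'd h p (delta_mx 0 i)| < eta / m.+1%:R.
  by have /cvgrPdistC_lt/(_ _ e0) := ch (delta_mx 0 i).
have H := filter_forall (nbhs_filter p) Hi.
apply: filterS2 dh H => q dhq Hq; split => //.
by apply: linear_rV_dist_bound => [|i]; apply: ltW.
Qed.

(** The mean value inequality, applied to the coordinates of
    t |-> h (v + t (u - v)) - t A (u - v) on the unit interval. *)
Lemma mean_value (V : normedModType R) n (h : V -> 'rV[R]_n)
    (A : {linear V -> 'rV[R]_n}) (u v : V) (eta : R) :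
  0 <= eta ->
  (forall t : R, 0 <= t <= 1 -> differentiable h (v + t *: (u - v)) /\
     forall w, `|'d h (v + t *: (u - v)) w - A w| <= eta * `|w|) ->
  `|h u - h v - A (u - v)| <= eta * `|u - v|.
Proof.
move=> eta0 H; apply: norm_le_coord => [|i]; first by rewrite mulr_ge0.
pose s (t : R) := v + t *: (u - v).
pose g (t : R) := h (s t) - t *: A (u - v).
have ds (t : R) : is_diff t s ( *:%R^~ (u - v)).
  by rewrite /s; apply: is_diff_eq; rewrite add0r.
have dg (t : R) : 0 <= t <= 1 -> is_diff t g
    ('d h (s t) \o ( *:%R^~ (u - v)) - ( *:%R^~ (A (u - v)))).
  move=> t01; have [dh _] := H t t01.
  apply: is_diffB; apply: is_diff_comp; exact: differentiableP.
have dgi (t : R) : 0 <= t <= 1 -> is_derive t 1 (fun t => g t 0 i)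
    (('d h (s t) (u - v) - A (u - v)) 0 i).
  move=> /dg dgt; have dv : derivable g t 1 by exact: diff_derivable.
  apply: DeriveDef; first by have /derivable_mxP := dv; exact.
  have := deriveE (1 : R) (@ex_diff _ _ _ _ _ _ _ dgt); rewrite diff_val derive_mx //.
  move=> /rowP/(_ i); rewrite [in LHS]mxE => ->.
  by rewrite -[LHS]/(('d h (s t) (1 *: (u - v)) - 1 *: A (u - v)) 0 i) !scale1r.
have dgo (t : R) : t \in `]0, 1[%R -> is_derive t 1 (fun t => g t 0 i)
    (('d h (s t) (u - v) - A (u - v)) 0 i).
  by rewrite in_itv/= => /andP[/ltW t0 /ltW t1]; apply: dgi; rewrite t0.
have cg : {within `[0, 1], continuous (fun t => g t 0 i)}.
  apply: derivable_within_continuous => t; rewrite in_itv/= => /dgi dt.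
  exact: ex_derive.
have [c] := MVT_segment ler01 dgo cg.
rewrite in_itv/= subr0 mulr1 => c01.
rewrite /g /s scale0r scale1r addr0 subrKC scale0r subr0 scale1r.
rewrite (_ : (h u - A (u - v)) 0 i - h v 0 i = (h u - h v - A (u - v)) 0 i); last first.
  by rewrite !mxE; ring.
move=> ->; apply: le_trans (coord_le_norm _ _) _.
by have [_] := H c c01; exact.
Qed.

End Calculus.

(** * Differentiable maps into a manifold *)

Section Charts.
Variables (R : realType) (d : nat) (M : manifold R d).
Local Notation vec := 'rV[R]_d.
Implicit Types (x y z : M).

Lemma cod_chartK z p : (chart z @` dom z) p ->
  dom z (param z p) /\ chart z (param z p) = p.
Proof. by move=> [y zy <-]; rewrite chartK. Qed.

Lemma nbhs_dom z y : dom z y -> nbhs y (dom z).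
Proof. by move=> zy; apply: open_nbhs_nbhs; split => //; exact: dom_open. Qed.

Lemma nbhs_cod z y : dom z y -> nbhs (chart z y) (chart z @` dom z).
Proof.
by move=> zy; apply: open_nbhs_nbhs; split; [exact: codom_open|exists y].
Qed.

Lemma param_continuous_chart z y : dom z y ->
  {for chart z y, continuous (param z)}.
Proof. by move=> zy; apply: param_continuous; exists y. Qed.

Lemma C1at_transition y z w : dom y w -> dom z w ->
  C1at (chart z \o param y) (chart y w).
Proof.
move=> yw zw.
apply: (@Cn1_C1at _ _ _ (chart y @` (dom y `&` dom z))); last first.
  exact: (@transition_smooth _ _ M y z 1%N).
have := nbhs_cod yw.
have : nbhs (chart y w) (param y @^-1` dom z).
  by apply: (param_continuous_chart yw); rewrite chartK //; exact: nbhs_dom.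
apply: filterS2 => p zp yp.
have [yp' pE] := cod_chartK yp.
by exists (param y p).
Qed.

Section Maps.
Variables (V : normedModType R).
Implicit Types (h : V -> M) (p : V).

(** Being C^1 at p for a map into the manifold, read in the preferred chart at
    h p; [C1M_chart] shows that every chart around h p does as well. *)
Definition C1M h (p : V) : Prop :=
  {for p, continuous h} /\ C1at (chart (h p) \o h) p.

Lemma near_dom h p z : {for p, continuous h} -> dom z (h p) ->
  \forall q \near p, dom z (h q).
Proof. by move=> ch zp; apply: ch; exact: nbhs_dom. Qed.

Lemma C1at_rechart h p y z : {for p, continuous h} ->
  dom y (h p) -> dom z (h p) -> C1at (chart y \o h) p -> C1at (chart z \o h) p.
Proof.
move=> ch yp zp Ch.
apply: (@near_eq_C1at _ _ _ ((chart z \o param y) \o (chart y \o h))).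
  by apply: filterS (near_dom ch yp) => q yq /=; rewrite chartK.
exact: (C1at_comp Ch (C1at_transition yp zp)).
Qed.

Lemma C1M_chart h p z : C1M h p -> dom z (h p) -> C1at (chart z \o h) p.
Proof.
by move=> [ch Ch] zp; apply: C1at_rechart Ch => //; exact: dom_center.
Qed.

Lemma near_eq_C1M (g h : V -> M) p :
  (\forall q \near p, g q = h q) -> C1M g p -> C1M h p.
Proof.
move=> gh [cg Cg]; have ghp := nbhs_singleton gh; split.
  rewrite /prop_for /continuous_at -ghp; apply: cvg_trans cg.
  by apply: near_eq_cvg; apply: filterS gh => q /= ->.
rewrite -ghp; apply: near_eq_C1at Cg.
by apply: filterS gh => q /= ->.
Qed.

Lemma C1into_C1M (U : set V) h p : nbhs p U -> C1into U h -> C1M h p.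
Proof.
move=> Up [ch Ch]; have chp := ch p (nbhs_singleton Up); split => //.
apply: Cn1_C1at (Ch (h p)); apply: filterI => //.
by apply: near_dom => //; exact: dom_center.
Qed.

Lemma C1M_C1into (U : set V) h : (forall p, U p -> C1M h p) -> C1into U h.
Proof.
move=> H; split=> [p /H[]//|y]; apply: C1at_Cn1 => p [/H Ch yp].
exact: C1M_chart.
Qed.

(** The tangent map may be computed in any chart z around h p, then transported
    to the preferred coordinates at h p by the tangent map of [param z]. *)
Lemma tangent_chart h p z v : C1M h p -> dom z (h p) ->
  tangent h p v = tangent (param z) (chart z (h p)) ('d (chart z \o h) p v).
Proof.
move=> Ch zp; have := C1M_chart Ch zp => /C1at_diff dzh.
have dt : differentiable (chart (h p) \o param z) (chart z (h p)).
  by apply: C1at_diff; apply: C1at_transition => //; exact: dom_center.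
have nE : \forall q \near p,
    (chart (h p) \o param z) ((chart z \o h) q) = (chart (h p) \o h) q.
  by apply: filterS (near_dom Ch.1 zp) => q zq /=; rewrite chartK.
rewrite /tangent (chartK zp); exact: (near_diff_comp (erefl _) nE dzh dt v).
Qed.

End Maps.

Lemma C1M_param z y : dom z y -> C1M (param z) (chart z y).
Proof.
move=> zy; split; first exact: param_continuous_chart.
by rewrite (chartK zy); apply: C1at_transition => //; exact: dom_center.
Qed.

Lemma tangent_param_id z v : tangent (param z) (chart z z) v = v.
Proof.
have zz := dom_center z; rewrite /tangent chartK //.
have nE : \forall q \near chart z z, idfun q = (chart z \o param z) q.
  by apply: filterS (nbhs_cod zz) => p /cod_chartK[].
have [|_ ->] := near_eq_is_diff nE; first exact: ex_diff.
by rewrite diff_val.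
Qed.

Section Compose.
Variables (V : normedModType R).

Lemma C1M_precomp (k : vec -> M) (h : V -> vec) p :
  C1at h p -> C1M k (h p) -> C1M (k \o h) p.
Proof.
move=> Ch [ck Ck].
have ch : {for p, continuous h} by exact: (differentiable_continuous (C1at_diff Ch)).
split; first exact: continuous_comp.
exact: (@C1at_comp _ _ _ _ h (chart (k (h p)) \o k)).
Qed.

Lemma C1map_C1M (f : M -> M) z y : C1map f -> dom z y ->
  C1M (f \o param z) (chart z y).
Proof. by move=> /(_ z) Cf zy; apply: C1into_C1M Cf; exact: nbhs_cod. Qed.

Lemma C1M_comp (f : M -> M) (h : V -> M) p :
  C1map f -> C1M h p -> C1M (f \o h) p.
Proof.
move=> Cf Ch; have zp := dom_center (h p).
apply: (@near_eq_C1M _ ((f \o param (h p)) \o (chart (h p) \o h))).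
  by apply: filterS (near_dom Ch.1 zp) => q zq /=; rewrite chartK.
by apply: C1M_precomp; [exact: C1M_chart|exact: C1map_C1M].
Qed.

Lemma tangent_comp (f : M -> M) (h : V -> M) p v :
  C1map f -> C1M h p -> tangent (f \o h) p v = D f (h p) (tangent h p v).
Proof.
move=> Cf Ch; have zp := dom_center (h p).
have Cfp := C1map_C1M Cf zp.
have df : differentiable (chart (f (h p)) \o (f \o param (h p))) (chart (h p) (h p)).
  by have := C1at_diff Cfp.2; rewrite /= chartK.
have dh : differentiable (chart (h p) \o h) p := C1at_diff Ch.2.
have nE : \forall q \near p, (chart (f (h p)) \o (f \o param (h p)))
    ((chart (h p) \o h) q) = (chart (f (h p)) \o (f \o h)) q.
  by apply: filterS (near_dom Ch.1 zp) => q zq /=; rewrite chartK.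
have E2 : (f \o param (h p)) (chart (h p) (h p)) = f (h p) by rewrite /= chartK.
rewrite /D /tangent E2; exact: (near_diff_comp (erefl _) nE dh df v).
Qed.

End Compose.

Lemma C1map_comp (f g : M -> M) : C1map f -> C1map g -> C1map (f \o g).
Proof.
move=> Cf Cg x; apply: C1M_C1into => _ [y xy <-].
by apply: (C1M_comp Cf (h := g \o param x)); exact: C1map_C1M.
Qed.

Lemma C1map_id : C1map (@id M).
Proof. by move=> x; apply: C1M_C1into => _ [y xy <-]; exact: C1M_param. Qed.

Lemma C1map_iter (f : M -> M) n : C1map f -> C1map (iter n f).
Proof.
move=> Cf; elim: n => [|n IH]; first exact: C1map_id.
exact: (C1map_comp Cf IH).
Qed.

Lemma C1map_continuous (f : M -> M) : C1map f -> continuous f.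
Proof.
move=> Cf x; have xx := dom_center x.
have := (C1map_C1M Cf xx).1; have := chart_continuous xx.
rewrite /prop_for /continuous_at /= chartK // => cc cf.
apply: (@cvg_trans _ (((f \o param x) \o chart x) y @[y --> x])); last first.
  exact: (cvg_comp _ _ cc cf).
apply: near_eq_cvg.
by apply: filterS (nbhs_dom xx) => y xy /=; rewrite chartK.
Qed.

Lemma D_comp (f g : M -> M) x v : C1map f -> C1map g ->
  D (f \o g) x v = D f (g x) (D g x v).
Proof.
move=> Cf Cg; have xx := dom_center x.
rewrite {1}/D (_ : (f \o g) \o param x = f \o (g \o param x)) //.
by rewrite (tangent_comp _ Cf (C1map_C1M Cg xx)) /= chartK.
Qed.

Lemma D_id x v : D id x v = v.
Proof. exact: tangent_param_id. Qed.

End Charts.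

(** * The Riemannian norm in charts *)

Section Riemann.
Variables (R : realType) (d : nat) (M : manifold R d) (G : riemannian M).
Local Notation vec := 'rV[R]_d.
Implicit Types (x y z : M) (u v w : vec).

Definition rdot x u v : R := (u *m gram G x *m v^T) 0 0.

Lemma rdotDl x u v w : rdot x (u + v) w = rdot x u w + rdot x v w.
Proof. by rewrite /rdot !mulmxDl mxE. Qed.

Lemma rdotZl x (a : R) v w : rdot x (a *: v) w = a * rdot x v w.
Proof. by rewrite /rdot -!scalemxAl mxE. Qed.

Lemma rdotC x v w : rdot x v w = rdot x w v.
Proof.
rewrite /rdot -[in LHS](trmxK (v *m _ *m _)) [LHS]mxE.
by rewrite !trmx_mul trmxK gram_sym mulmxA.
Qed.

Lemma rdotDr x u v w : rdot x w (u + v) = rdot x w u + rdot x w v.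
Proof. by rewrite rdotC rdotDl !(rdotC _ _ w). Qed.

Lemma rdotZr x (a : R) v w : rdot x w (a *: v) = a * rdot x w v.
Proof. by rewrite rdotC rdotZl (rdotC _ _ w). Qed.

Lemma rdot0 x w : rdot x 0 w = 0.
Proof. by rewrite /rdot !mul0mx mxE. Qed.

Lemma rdot_ge0 x v : 0 <= rdot x v v.
Proof.
have [->|v0] := eqVneq v 0; first by rewrite rdot0.
exact/ltW/gram_pos.
Qed.

Lemma rnorm_ge0 x v : 0 <= rnorm G x v.
Proof. exact: sqrtr_ge0. Qed.

Lemma rnorm_sqr x v : rnorm G x v ^+ 2 = rdot x v v.
Proof. by rewrite sqr_sqrtr //; exact: rdot_ge0. Qed.

Lemma rnormZ x (a : R) v : rnorm G x (a *: v) = `|a| * rnorm G x v.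
Proof.
rewrite /rnorm -/(rdot x (a *: v) (a *: v)) rdotZl rdotZr mulrA -expr2.
by rewrite sqrtrM ?sqr_ge0 // sqrtr_sqr.
Qed.

Lemma rnorm0 x : rnorm G x 0 = 0.
Proof. by rewrite -(scale0r 0) rnormZ normr0 mul0r. Qed.

Lemma rnormN x v : rnorm G x (- v) = rnorm G x v.
Proof. by rewrite -scaleN1r rnormZ normrN1 mul1r. Qed.

(** Expand the nonnegative square of <v,v> u - <u,v> v. *)
Lemma rdot_cauchy x u v : rdot x u v <= rnorm G x u * rnorm G x v.
Proof.
have [->|v0] := eqVneq v 0; first by rewrite rdotC rdot0 rnorm0 mulr0.
have Q0 : 0 < rdot x v v := gram_pos G x v0.
have := rdot_ge0 x (rdot x v v *: u + (- rdot x u v) *: v).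
rewrite !(rdotDl, rdotDr, rdotZl, rdotZr) (rdotC x v u) => H.
have : rdot x u v ^+ 2 <= rdot x u u * rdot x v v.
  rewrite -subr_ge0 -(pmulr_rge0 _ Q0); apply: le_trans H _.
  by rewrite le_eqVlt; apply/orP; left; apply/eqP; ring.
rewrite -!rnorm_sqr -exprMn -[X in X <= _]real_normK ?num_real // => H2.
apply: le_trans (ler_norm _) _.
by rewrite -(ler_pXn2r (n := 2)) // ?nnegrE ?mulr_ge0 ?rnorm_ge0.
Qed.

Lemma rnorm_triangle x u v : rnorm G x (u + v) <= rnorm G x u + rnorm G x v.
Proof.
rewrite -(ler_pXn2r (n := 2)) // ?nnegrE ?addr_ge0 ?rnorm_ge0 //.
rewrite rnorm_sqr rdotDl !rdotDr sqrrD !rnorm_sqr (rdotC x v u).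
have := rdot_cauchy x u v; lra.
Qed.

Lemma compact_sphere : compact [set v : vec | `|v| = 1].
Proof.
apply: bounded_closed_compact.
  exists 1; split => // a a1 v /= ->; exact: ltW.
rewrite (_ : mkset _ = (fun v : vec => `|v|) @^-1` [set 1]) //.
by apply: closed_comp => [v _|]; [exact: norm_continuous|exact: closed_eq].
Qed.

Lemma rdot_continuous x : continuous (fun v : vec => rdot x v v).
Proof.
rewrite /rdot => v; rewrite (_ : (fun v : vec => _) =
   (fun v => \sum_j (\sum_i v 0 i * gram G x i j) * v 0 j)); last first.
  apply/funext => w; rewrite mxE; apply: eq_bigr => j _; rewrite !mxE.
  by congr (_ * _); apply: eq_bigr.
have sumc n (F : 'I_n -> vec -> R) : (forall i, continuous (F i)) ->
    continuous (fun v => \sum_i F i v).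
  move=> cF w; exact: (cvg_big add_continuous (nbhs_filter w) (fun i _ => cF i w)).
move: v; apply: (sumc) => j v.
apply: (@cvgM _ _ (nbhs v) (nbhs_filter v)); last exact: coord_continuous.
move: v; apply: (sumc) => i v.
apply: (@cvgM _ _ (nbhs v) (nbhs_filter v)); first exact: coord_continuous.
exact: (@cvg_cst _ _ _ _ (nbhs_filter v)).
Qed.

Lemma rnorm_continuous x : continuous (rnorm G x).
Proof.
move=> v; apply: (@continuous_comp _ _ _ (fun v => rdot x v v) Num.sqrt).
  exact: rdot_continuous.
exact: sqrt_continuous.
Qed.

(** The two norms are compared on the unit sphere of the coordinate norm, where
    the Riemannian norm attains a positive minimum and a maximum.  In dimension
    0 the sphere is empty. *)
Lemma rnorm_equiv x : exists C : R, 1 <= C /\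
  forall v, rnorm G x v <= C * `|v| /\ `|v| <= C * rnorm G x v.
Proof.
have [S0|S0] := pselect ([set v : vec | `|v| = 1] = set0).
  have v0 v : v = 0.
    apply/eqP; apply: contraT => vn0.
    have : [set v : vec | `|v| = 1] (`|v|^-1 *: v).
      by rewrite /= normrZ ger0_norm ?invr_ge0 // mulVf // normr_eq0.
    by rewrite S0.
  by exists 1; split => // v; rewrite (v0 v) rnorm0 !normr0 !mulr0.
have {}S0 : [set v : vec | `|v| = 1] !=set0 by apply/set0P/eqP.
have cN : {within [set v : vec | `|v| = 1], continuous (rnorm G x)}.
  exact/continuous_subspaceT/rnorm_continuous.
have [a aS aM] := EVT_max_rV S0 compact_sphere cN.
have [b bS bm] := EVT_min_rV S0 compact_sphere cN.
have b0 : 0 < rnorm G x b.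
  rewrite sqrtr_gt0; apply: gram_pos; apply: contraTneq bS => ->.
  by apply/negP; rewrite inE /= normr0 => /esym/eqP; rewrite oner_eq0.
have ra := rnorm_ge0 x a; have rb : 0 < (rnorm G x b)^-1 by rewrite invr_gt0.
pose C := 1 + rnorm G x a + (rnorm G x b)^-1.
exists C; split; first by rewrite /C -addrA lerDl addr_ge0 ?rnorm_ge0 ?invr_ge0 ?rnorm_ge0.
move=> v; have [->|v0] := eqVneq v 0; first by rewrite rnorm0 !normr0 !mulr0.
have vS : (`|v|^-1 *: v) \in [set v : vec | `|v| = 1].
  by rewrite inE /= normrZ ger0_norm ?invr_ge0 // mulVf // normr_eq0.
have vp : 0 < `|v| by rewrite normr_gt0.
have := aM _ vS; have := bm _ vS; rewrite rnormZ ger0_norm ?invr_ge0 // => h1 h2.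
split.
  rewrite -ler_pdivrMr // mulrC; apply: le_trans h2 _.
  by rewrite /C; lra.
rewrite ler_pdivlMl // in h1.
have C0 : 0 < C by rewrite /C; lra.
rewrite -ler_pdivrMl //; apply: le_trans h1; rewrite mulrC ler_pM2l //.
by rewrite -[leRHS]invrK lef_pV2 ?posrE //; rewrite /C; lra.
Qed.

(** Lets an approximation of w with a small relative error be replaced by w at
    the cost of a factor close to 1, in both directions. *)
Lemma rnorm_perturb x (a : R) : 1 < a -> exists2 eta : R, 0 < eta &
  forall v w, `|v - w| <= eta * `|w| ->
    rnorm G x v <= a * rnorm G x w /\ rnorm G x w <= a * rnorm G x v.
Proof.
move=> a1; have [C [C1 HC]] := rnorm_equiv x.
have C0 : 0 < C by apply: lt_le_trans C1.
pose e := (a - 1) / a; have e0 : 0 < e by rewrite divr_gt0 //; lra.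
have ea : a * e = a - 1 by rewrite /e mulrCA mulfV ?mulr1 // gt_eqF //; lra.
have e1 : e <= a - 1.
  by rewrite -ea ler_peMl ?ltW.
exists (e / C ^+ 2); first by rewrite divr_gt0 ?exprn_gt0.
move=> v w vw.
have K : rnorm G x (v - w) <= e * rnorm G x w.
  apply: le_trans (HC _).1 _.
  apply: (@le_trans _ _ (C * (e / C ^+ 2 * (C * rnorm G x w)))).
    rewrite ler_pM2l //; apply: le_trans vw _.
    by rewrite ler_wpM2l ?(HC w).2 // divr_ge0 ?exprn_ge0 ?ltW.
  rewrite le_eqVlt; apply/orP; left; apply/eqP; field; lra.
have T1 := rnorm_triangle x w (v - w).
have T2 := rnorm_triangle x v (w - v).
rewrite subrKC in T1; rewrite subrKC -(rnormN _ (w - v)) opprB in T2.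
have n0 := rnorm_ge0 x w.
split; first by nra.
rewrite -(ler_pM2l (x := a^-1)) ?invr_gt0 ?mulKf ?gt_eqF //; try lra.
have : a^-1 = 1 - e by rewrite /e; field; lra.
by move=> ->; nra.
Qed.

(** The Riemannian metric read in the chart z. *)
Definition mnorm z (p : vec) v : R := rnorm G (param z p) (tangent (param z) p v).

Lemma mnorm_chart z v : mnorm z (chart z z) v = rnorm G z v.
Proof. by rewrite /mnorm tangent_param_id chartK //; exact: dom_center. Qed.

Lemma mnorm_sqr z p v : mnorm z p v ^+ 2 =
  \sum_i \sum_j v 0 i * v 0 j *
    rdot (param z p) (tangent (param z) p (delta_mx 0 i))
                     (tangent (param z) p (delta_mx 0 j)).
Proof.
rewrite /mnorm rnorm_sqr /tangent.
move: ('d _ p) => A; rewrite !(linear_rV_sum A v).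
have suml (n : nat) (F : 'I_n -> vec) w : rdot (param z p) (\sum_i F i) w =
    \sum_i rdot (param z p) (F i) w.
  elim/big_rec2: _ => [|i a b _ <-]; first by rewrite rdot0.
  by rewrite rdotDl.
rewrite suml; apply: eq_bigr => i _; rewrite rdotC suml; apply: eq_bigr => j _.
by rewrite rdotC rdotZl rdotZr mulrA.
Qed.

Lemma gram_chart_continuous z y u v : dom z y ->
  {for chart z y, continuous (fun p =>
     rdot (param z p) (tangent (param z) p u) (tangent (param z) p v))}.
Proof.
move=> zy; apply: (gram_smooth G z u v 0%N); by exists y.
Qed.

(** The coefficients of the metric in a chart are continuous, and the metric is
    positive definite at z, so that the norms at nearby points agree with that
    at z up to a factor close to 1. *)
Lemma mnorm_near z (a : R) : 1 < a -> \forall p \near chart z z, forall v,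
  mnorm z p v <= a * rnorm G z v /\ rnorm G z v <= a * mnorm z p v.
Proof.
move=> a1; have [C [C1 HC]] := rnorm_equiv z.
have C0 : 0 < C by apply: lt_le_trans C1.
have a2 : 1 < a ^+ 2 by rewrite exprn_egt1.
pose e := (a ^+ 2 - 1) / a ^+ 2.
have e0 : 0 < e by rewrite divr_gt0 //; lra.
have ea : a ^+ 2 * e = a ^+ 2 - 1 by rewrite /e mulrCA mulfV ?mulr1 // gt_eqF //; lra.
have e1 : e <= a ^+ 2 - 1 by rewrite -ea ler_peMl ?ltW.
pose S i j p := rdot (param z p) (tangent (param z) p (delta_mx 0 i))
                     (tangent (param z) p (delta_mx 0 j)).
have SE p v : mnorm z p v ^+ 2 =
    \sum_(ij : 'I_d * 'I_d) v 0 ij.1 * v 0 ij.2 * S ij.1 ij.2 p.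
  by rewrite mnorm_sqr pair_big.
have Sc i j : {for chart z z, continuous (S i j)}.
  exact: (@gram_chart_continuous z z _ _ (dom_center z)).
clearbody S.
pose e' := e / C ^+ 2 / (d ^ 2).+1%:R.
have e'0 : 0 < e' by apply: divr_gt0 => //; apply: divr_gt0 => //; exact: exprn_gt0.
have Hij (ij : 'I_d * 'I_d) : \forall p \near chart z z,
    `|S ij.1 ij.2 p - S ij.1 ij.2 (chart z z)| < e'.
  by have /cvgrPdistC_lt/(_ _ e'0) := Sc ij.1 ij.2.
have := filter_forall (nbhs_filter _) Hij; apply: filterS => p Hp v.
have n0 := rnorm_ge0 z v; have m0 : 0 <= mnorm z p v := rnorm_ge0 _ _.
have K : `|mnorm z p v ^+ 2 - rnorm G z v ^+ 2| <= e * rnorm G z v ^+ 2.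
  have E2 : rnorm G z v ^+ 2 =
      \sum_(ij : 'I_d * 'I_d) v 0 ij.1 * v 0 ij.2 * S ij.1 ij.2 (chart z z).
    by rewrite -SE mnorm_chart.
  have -> : mnorm z p v ^+ 2 - rnorm G z v ^+ 2 = \sum_(ij : 'I_d * 'I_d)
      v 0 ij.1 * v 0 ij.2 * (S ij.1 ij.2 p - S ij.1 ij.2 (chart z z)).
    by rewrite SE E2 -sumrB; apply: eq_bigr => ij _; rewrite -mulrBr.
  apply: le_trans (ler_norm_sum _ _ _) _.
  apply: (@le_trans _ _ (\sum_(p : 'I_d * 'I_d) `|v| ^+ 2 * e')).
    apply: ler_sum => ij _; rewrite !normrM.
    by rewrite ler_pM ?mulr_ge0 ?expr2 ?ler_pM ?coord_le_norm //; apply/ltW/(Hp ij).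
  rewrite sumr_const card_prod !card_ord -[leLHS]mulr_natr.
  apply: (@le_trans _ _ (`|v| ^+ 2 * (e / C ^+ 2))).
    rewrite -[leLHS]mulrA ler_wpM2l ?exprn_ge0 // /e' -[leLHS]mulrA.
    apply: ler_piMr; first by rewrite divr_ge0 ?exprn_ge0 ?ltW.
    by rewrite mulrC ler_pdivrMr // mul1r ler_nat -mulnn leqnSn.
  rewrite [leLHS]mulrCA ler_wpM2l ?(ltW e0) // ler_pdivrMr ?exprn_gt0 //.
  by rewrite -exprMn ler_pXn2r ?nnegrE ?mulr_ge0 ?(ltW C0) // mulrC (HC v).2.
have a0 : 0 < a by lra.
rewrite ler_norml in K; move/andP: K => [K1 K2].
split.
  rewrite -(ler_pXn2r (n := 2)) // ?nnegrE ?mulr_ge0 ?(ltW a0) // exprMn.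
  have := sqr_ge0 (rnorm G z v); nra.
rewrite -(ler_pXn2r (n := 2)) // ?nnegrE ?mulr_ge0 ?(ltW a0) // exprMn.
have := sqr_ge0 (rnorm G z v); nra.
Qed.

End Riemann.

(** * Lengths of curves and the Riemannian distance in a chart *)

Section Lengths.
Variables (R : realType) (d : nat) (M : manifold R d) (G : riemannian M).
Local Notation vec := 'rV[R]_d.
Implicit Types (x y z : M) (c : R -> M).

Definition speed c (t : R) : R := rnorm G (c t) (tangent c t 1).

Lemma speed_chart c t z : C1M c t -> dom z (c t) ->
  speed c t = mnorm G z (chart z (c t)) ('d (chart z \o c) t 1).
Proof.
by move=> Cc zt; rewrite /speed /mnorm (tangent_chart _ Cc zt) (chartK zt).
Qed.

Lemma speed_continuous c t : (\forall s \near t, C1M c s) ->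
  {for t, continuous (speed c)}.
Proof.
move=> nC; have Ct := nbhs_singleton nC; pose z := c t.
have zt : dom z (c t) := dom_center _.
pose Q s := \sum_i \sum_j
    ('d (chart z \o c) s 1) 0 i * ('d (chart z \o c) s 1) 0 j *
    rdot G (param z (chart z (c s))) (tangent (param z) (chart z (c s)) (delta_mx 0 i))
       (tangent (param z) (chart z (c s)) (delta_mx 0 j)).
have nE : \forall s \near t, Num.sqrt (Q s) = speed c s.
  have := near_dom Ct.1 zt; move: nC; apply: filterS2 => s Cs zs.
  rewrite (@speed_chart c s z) //.
  by rewrite /Q -mnorm_sqr sqrtr_sqr ger0_norm //; exact: rnorm_ge0.
have cQ : Q s @[s --> t] --> Q t.
  have [_ /(_ 1) dc] := C1M_chart Ct zt.
  have cc : chart z (c s) @[s --> t] --> chart z (c t).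
    exact: (cvg_comp _ _ Ct.1 (chart_continuous zt)).
  apply: cvg_big => [|i _]; first exact: add_continuous.
  apply: cvg_big => [|j _]; first exact: add_continuous.
  apply: cvgM; first (apply: cvgM).
  - exact: (cvg_comp _ _ dc (@coord_continuous _ _ _ 0 i _)).
  - exact: (cvg_comp _ _ dc (@coord_continuous _ _ _ 0 j _)).
  - exact: (cvg_comp _ _ cc (@gram_chart_continuous _ _ _ G z (c t) _ _ zt)).
rewrite /prop_for /continuous_at -(nbhs_singleton nE).
apply: (@cvg_trans _ (Num.sqrt (Q s) @[s --> t])).
  by apply: near_eq_cvg; apply: filterS nE.
exact: (cvg_comp _ _ cQ (@sqrt_continuous _ _)).
Qed.

Lemma C1curve_C1M c : C1curve c -> exists U : set R,
  [/\ open U, `[0, 1]%classic `<=` U & forall t, U t -> C1M c t].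
Proof.
move=> [U [oU U01 Cc]]; exists U; split => // t Ut.
by apply: C1into_C1M Cc; exact: open_nbhs_nbhs.
Qed.

Lemma speed_integrable c : C1curve c ->
  lebesgue_measure.-integrable `[0, 1]%classic (EFin \o speed c).
Proof.
move=> /C1curve_C1M [U [oU U01 Cc]].
apply: continuous_compact_integrable; first exact: segment_compact.
apply: continuous_in_subspaceT => t; rewrite inE => /U01 Ut.
apply: speed_continuous; have : nbhs t U by exact: open_nbhs_nbhs.
by apply: filterS => s /Cc.
Qed.

Lemma speed_ge0 c t : 0 <= speed c t. Proof. exact: rnorm_ge0. Qed.

(** Integrate the derivative of each coordinate of the curve: its absolute value
    is at most C times the speed.  Only the part of the curve on [0, s] is
    assumed to lie in the chart, so that the bound can be used before the curve
    is known to stay there. *)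
Lemma chart_displacement c z (C s : R) : 0 <= C -> C1curve c -> 0 < s <= 1 ->
  (forall t, 0 <= t <= s -> dom z (c t) /\
     forall v, `|v| <= C * mnorm G z (chart z (c t)) v) ->
  ((`|chart z (c s) - chart z (c 0%R)|)%:E <= C%:E * curve_length G c)%E.
Proof.
move=> C0 Cc /andP[s0 s1] H.
have ispd := speed_integrable Cc.
have mspd := measurable_int _ ispd.
have [U [oU U01 CM]] := C1curve_C1M Cc.
have CMt t : 0 <= t <= s -> C1M c t.
  by move=> /andP[t0 ts]; apply/CM/U01; rewrite /= in_itv /= t0 (le_trans ts).
pose g := chart z \o c.
have Cg t : 0 <= t <= s -> C1at g t.
  by move=> ts; apply: C1M_chart; [exact: CMt|exact: (H t ts).1].
have s01 : `[0, s]%classic `<=` (`[0, 1]%classic : set R).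
  by move=> t /=; rewrite !in_itv /= => /andP[-> /le_trans]; exact.
have lge0 : (0 <= curve_length G c)%E.
  by apply: integral_ge0 => t _; rewrite lee_fin speed_ge0.
have lfin : curve_length G c \is a fin_num by exact: integrable_fin_num ispd.
have Hi i : `|g s 0 i - g 0 0 i| <= C * fine (curve_length G c).
  pose f t := ('d g t 1) 0 i : R.
  have cf : {within `[0, s], continuous f}.
    apply: continuous_in_subspaceT => t; rewrite inE /= in_itv /= => /Cg [_ /(_ 1) dc].
    exact: (cvg_comp _ _ dc (@coord_continuous _ _ _ 0 i _)).
  have dF t : 0 <= t <= s -> is_derive t 1 (fun t => g t 0 i) (f t).
    move=> /Cg /C1at_diff dg.
    have dv : derivable g t 1 by exact: diff_derivable.
    apply: DeriveDef; first by have /derivable_mxP := dv; exact.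
    by have := deriveE (1 : R) dg; rewrite derive_mx // => /rowP/(_ i); rewrite mxE.
  have cF t : 0 <= t <= s -> {for t, continuous (fun t => g t 0 i)}.
    move=> /dF dFt; apply: differentiable_continuous; apply/derivable1_diffP.
    exact: ex_derive.
  have itv t : t \in `]0, s[%R -> 0 <= t <= s.
    by rewrite in_itv /= => /andP[/ltW -> /ltW ->].
  have := @continuous_FTC2 _ f (fun t => g t 0 i) 0 s s0 cf.
  move=> FTC; have {}FTC : (\int[lebesgue_measure]_(x in `[0%R, s]) (f x)%:E)%E =
      ((g s 0 i)%:E - (g 0 0 i)%:E)%E.
    apply: FTC; first split.
    - by move=> t /itv /dF dFt; exact: ex_derive.
    - by apply: cvg_at_right_filter; apply: cF; rewrite lexx ltW.
    - by apply: cvg_at_left_filter; apply: cF; rewrite lexx ltW.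
    - by move=> t /itv /dF dFt; rewrite derive1E derive_val.
  have if_ := continuous_compact_integrable (@segment_compact _ 0 s) cf.
  have mf := measurable_int _ if_.
  rewrite -lee_fin EFinM fineK //.
  rewrite (_ : (`|g s 0 i - g 0 0 i|%:E = `|(g s 0 i)%:E - (g 0 0 i)%:E|)%E) // -FTC.
  apply: le_trans (le_abse_integral _ _ _) _ => //.
  rewrite -ge0_integralZl_EFin //; last by move=> t _; rewrite lee_fin speed_ge0.
  apply: (@le_trans _ _ (\int[lebesgue_measure]_(x in `[0%R, s]) (C%:E * (speed c x)%:E))%E); last first.
    apply: ge0_subset_integral => //; first by apply: measurable_funeM.
    by move=> t _; rewrite mule_ge0 // lee_fin ?speed_ge0.
  apply: ge0_le_integral => //.
  - exact: (measurable_int _ (integrable_abse if_)).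
  - by apply: measurable_funeM; apply: measurable_funS mspd.
  move=> t /=; rewrite in_itv /= => ts; rewrite lee_fin.
  have [zt Hv] := H t ts.
  rewrite (speed_chart (CMt t ts) zt).
  by apply: le_trans (Hv _); exact: coord_le_norm.
rewrite -(fineK lfin) -EFinM lee_fin; apply: norm_le_coord.
  by rewrite mulr_ge0 // fine_ge0.
by move=> i; have := Hi i; rewrite !mxE.
Qed.

(** A curve whose length is less than r / C cannot leave the ball of radius r of
    the chart.  Up to a first exit time T the displacement bound keeps the curve
    in the closed ball of radius C times the length; this set is compact, hence
    closed since the manifold is separated, so it contains c T, and it lies in
    the open ball of radius r, so the curve stays there for some time after T. *)
Lemma chart_confine c z P (C r : R) : 0 < C -> 0 < r -> C1curve c ->
  (forall q, `|q - P| < r -> (chart z @` dom z) q /\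
     forall v, `|v| <= C * mnorm G z q v) ->
  dom z (c 0) -> chart z (c 0) = P -> (C%:E * curve_length G c < r%:E)%E ->
  dom z (c 1) /\ ((`|chart z (c 1%R) - P|)%:E <= C%:E * curve_length G c)%E.
Proof.
move=> C0 r0 Cc Hr z0 c0 lr.
have lge0 : (0 <= curve_length G c)%E.
  by apply: integral_ge0 => t _; rewrite lee_fin speed_ge0.
have lfin : curve_length G c \is a fin_num.
  by exact: integrable_fin_num (speed_integrable Cc).
pose rho := C * fine (curve_length G c).
have rhoE : (C%:E * curve_length G c = rho%:E)%E by rewrite EFinM fineK.
rewrite rhoE lte_fin in lr; rewrite rhoE.
have rho0 : 0 <= rho by rewrite /rho mulr_ge0 ?fine_ge0 // ltW.
pose Kc y := dom z y /\ `|chart z y - P| <= rho.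
pose O y := dom z y /\ `|chart z y - P| < r.
have KO y : Kc y -> O y by move=> [? h]; split => //; exact: le_lt_trans h lr.
have KE : Kc = param z @` [set q | `|q - P| <= rho].
  apply/seteqP; split => y /=.
    by move=> [zy h]; exists (chart z y) => //; rewrite chartK.
  move=> [q h <-]; have [|zq _] := Hr q; first exact: le_lt_trans h lr.
  by have [? E] := cod_chartK zq; split; rewrite ?E.
have clK : closed Kc.
  rewrite KE; apply: compact_closed; first exact: manifold_hausdorff.
  apply: continuous_compact.
    apply: continuous_in_subspaceT => q; rewrite inE /= => h.
    by apply: param_continuous; have [|] := Hr q; first exact: le_lt_trans h lr.
  apply: bounded_closed_compact.
    exists (rho + `|P|); split; first exact: num_real.
    move=> a ha q /= h.
    rewrite -[q](subrK P); apply: le_trans (ler_normD _ _) _.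
    by apply: le_trans (ltW ha); rewrite lerD2r.
  have -> : [set q | `|q - P| <= rho] = closed_ball_ Num.norm P rho.
    by apply/seteqP; split => q /=; rewrite distrC.
  exact: closed_closed_ball_.
have nO y : O y -> nbhs y O.
  move=> [zy h]; have cy := chart_continuous zy.
  have nb : nbhs (chart z y) (fun q => `|q - P| < r).
    apply/nbhs_ballP; exists (r - `|chart z y - P|); rewrite /= ?subr_gt0 // => q.
    rewrite -ball_normE /= distrC ltrBrDr => hq.
    by apply: le_lt_trans hq; rewrite -[q - P](subrKA (chart z y)); exact: ler_normD.
  have nb' : nbhs y (fun w => `|chart z w - P| < r) := cy _ nb.
  by apply: filterS2 (nbhs_dom zy) nb' => w zw hw; split.
have cc t : 0 <= t <= 1 -> {for t, continuous c}.
  have [U [oU U01 CM]] := C1curve_C1M Cc.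
  by move=> t01; have [] := CM t; first by apply: U01; rewrite /= in_itv.
have step s : 0 < s <= 1 -> (forall t, 0 <= t <= s -> O (c t)) -> Kc (c s).
  move=> s01 Ht; have [s0 s1] := andP s01.
  split; first by have [] := Ht s; rewrite ?lexx ?andbT // ltW.
  rewrite -lee_fin -rhoE -c0; apply: chart_displacement => //; first exact: ltW.
  move=> t /Ht [zt h]; split => //; exact: (Hr _ h).2.
have K0 : Kc (c 0) by split => //; rewrite c0 subrr normr0.
(* The exit time is the supremum of S. *)
pose S : set R := [set t | 0 <= t <= 1 /\ forall s, 0 <= s <= t -> Kc (c s)].
have S0 : S 0.
  split; first by rewrite lexx ler01.
  by move=> s /andP[s0 s0']; have -> : s = 0 by apply: le_anti; rewrite s0 s0'.
have supS : has_sup S by split; [exists 0|exists 1 => t [/andP[]]].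
pose T := sup S.
have T0 : 0 <= T by exact: (sup_upper_bound supS S0).
have T1 : T <= 1 by apply: ge_sup; [exists 0|move=> t [/andP[]]].
have ltT s : 0 <= s -> s < T -> Kc (c s).
  move=> s0 /sup_gt [|t [t01 Ht] st]; first by exists 0.
  by apply: Ht; rewrite s0 ltW.
have KT : Kc (c T).
  have [<-//|Tn0] := eqVneq 0 T.
  have Tp : 0 < T by rewrite lt_neqAle Tn0.
  have cT : c s @[s --> T^'-] --> c T.
    by apply: cvg_at_left_filter; apply: cc; rewrite T0.
  apply: (closed_cvg _ clK _ _ cT).
  near=> s; apply: ltT; first by apply: ltW; near: s; exact: nbhs_left_gt.
  by near: s; exact: nbhs_left_lt.
have [TE|Tn1] := eqVneq T 1; first by move: KT; rewrite TE.
have Tl : T < 1 by rewrite lt_neqAle Tn1.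
have : nbhs T (fun s => O (c s)).
  by apply: (cc T _ _ (nO _ (KO _ KT))); rewrite T0.
move=> /nbhs_ballP [e /= e0 He].
pose t' := Num.min 1 (T + e / 2).
have tT : T < t' by rewrite lt_min Tl /= ltrDl divr_gt0.
have t1 : t' <= 1 by rewrite ge_min lexx.
have te : t' <= T + e / 2 by rewrite ge_min lexx orbT.
suff St : S t' by have := sup_upper_bound supS St; rewrite leNgt tT.
split; first by rewrite t1 (le_trans T0 (ltW tT)).
move=> s /andP[s0 st]; have [<-//|sn0] := eqVneq 0 s.
apply: step; first by rewrite lt_neqAle sn0 s0 (le_trans st).
move=> t /andP[tt0 ts]; have [tlt|Tt] := ltP t T; first by apply/KO/ltT.
apply: He; rewrite -ball_normE /= distrC ger0_norm ?subr_ge0 //.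
have := le_trans (le_trans ts st) te; lra.
Unshelve. all: by end_near. Qed.

(** The image of a straight segment of the chart is a curve of controlled
    length; the ball of radius r around p0 is convex. *)
Lemma segment_length z (P Q : vec) (C r : R) p0 : 0 <= C ->
  (forall q, `|p0 - q| < r -> (chart z @` dom z) q /\
     forall v, mnorm G z q v <= C * `|v|) ->
  `|p0 - P| < r -> `|p0 - Q| < r ->
  (rdist G (param z P) (param z Q) <= (C * `|P - Q|)%:E)%E.
Proof.
move=> C0 Hr hP hQ.
pose s (t : R) := P + t *: (Q - P).
have ds (t : R) : is_diff t s ( *:%R^~ (Q - P)).
  by rewrite /s; apply: is_diff_eq; rewrite add0r.
have Cs t : C1at s t.
  split; first by apply: filterE => q; have [] := ds q.
  move=> v; have -> : (fun q => 'd s q v) = cst (v *: (Q - P)).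
    by apply/funext => q; rewrite diff_val.
  exact: cst_continuous.
pose U : set R := s @^-1` ball p0 r.
have oU : open U.
  apply: open_comp; last exact: ball_open.
  by move=> t _; apply: differentiable_continuous; exact: C1at_diff.
have UO t : U t -> (chart z @` dom z) (s t) /\
     forall v, mnorm G z (s t) v <= C * `|v|.
  by rewrite /U /= -ball_normE; exact: Hr.
have U01 : `[0, 1]%classic `<=` U.
  move=> t /=; rewrite in_itv /= => /andP[t0 t1]; rewrite /U /= -ball_normE /=.
  have -> : p0 - s t = (1 - t) *: (p0 - P) + t *: (p0 - Q).
    rewrite /s !scalerBr !scalerBl !scale1r !opprD !opprK.
    by apply/rowP => i; rewrite !mxE; ring.
  apply: le_lt_trans (ler_normD _ _) _; rewrite !normrZ ger0_norm ?subr_ge0 // ger0_norm //.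
  have [->|tn0] := eqVneq t 0; first by rewrite subr0 mul1r mul0r addr0.
  have tp : 0 < t by rewrite lt_neqAle eq_sym tn0.
  nra.
pose c := param z \o s.
have CM t : U t -> C1M c t.
  move=> /UO [zt _]; apply: C1M_precomp => //.
  by have [y zy yE] := zt; rewrite -yE; exact: C1M_param.
have Cc : C1curve c by exists U; split => //; exact: C1M_C1into.
have sp t : U t -> speed c t <= C * `|P - Q|.
  move=> Ut; have [zt Hv] := UO t Ut; have [y zy yE] := zt.
  have -> : speed c t = mnorm G z (s t) (Q - P).
    rewrite /speed /mnorm; congr (rnorm _ _ _); rewrite /tangent.
    have nE : \forall q \near t, (chart (c t) \o param z) (s q) = (chart (c t) \o c) q.
      exact: filterE.
    have dk : differentiable (chart (c t) \o param z) (s t).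
      apply: C1at_diff; rewrite -yE; apply: C1at_transition => //.
      by rewrite /c /= -yE chartK //; exact: dom_center.
    have := near_diff_comp (erefl (s t)) nE (C1at_diff (Cs t)) dk 1.
    by rewrite [in X in _ = X -> _]diff_val scale1r.
  by rewrite (distrC P).
apply: (@le_trans _ _ (curve_length G c)).
  apply: ereal_inf_lbound; exists c => //; split => //; rewrite /c /= /s.
    by rewrite scale0r addr0.
  by rewrite scale1r subrKC.
apply: (@le_trans _ _ (\int[lebesgue_measure]_(x in `[0%R, 1%R]) cst (C * `|P - Q|)%:E x)%E).
  apply: ge0_le_integral => //.
  - by move=> t _; rewrite lee_fin speed_ge0.
  - exact: measurable_int (speed_integrable Cc).
  - by move=> t /U01 /sp; rewrite lee_fin.
have m01 := lebesgue_measure_itv (`[0, 1]%R : interval R).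
rewrite /= lte_fin ltr01 sube0 in m01.
by rewrite integral_cst // [X in (_ * X)%E]m01 mule1.
Qed.

Lemma rdist_ge0 x y : (0 <= rdist G x y)%E.
Proof.
apply/ereal_infP => _ [c _ <-].
by apply: integral_ge0 => t _; rewrite lee_fin speed_ge0.
Qed.

(** On a small ball of the chart at z the Riemannian distance is comparable to
    the coordinate distance.  For the lower bound, a curve either is short,
    hence confined to the larger ball of radius e ([chart_confine]), or has
    length at least a multiple of e, which exceeds the distance of two points of
    the ball of radius e / 3. *)
Lemma rdist_chart z : exists C r : R, [/\ 0 < C, 0 < r,
  forall q, `|chart z z - q| < r -> (chart z @` dom z) q &
  forall P Q, `|chart z z - P| < r -> `|chart z z - Q| < r ->
    (rdist G (param z P) (param z Q) <= (C * `|P - Q|)%:E)%E /\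
    ((`|P - Q|)%:E <= C%:E * rdist G (param z P) (param z Q))%E].
Proof.
have [C [C1 HC]] := rnorm_equiv G z.
have C0 : 0 < C by apply: lt_le_trans C1.
have /nbhs_ballP[e /= e0 He] : nbhs (chart z z) (fun q => (chart z @` dom z) q /\
    forall v, mnorm G z q v <= (2 * C) * `|v| /\ `|v| <= (2 * C) * mnorm G z q v).
  have n2 := mnorm_near G z (ltr1n R 2).
  have := nbhs_cod (dom_center z); apply: filterS2 n2 => q Hq zq; split => // v.
  have [h1 h2] := Hq v; have [h3 h4] := HC v; split.
    by apply: le_trans h1 _; rewrite -mulrA ler_pM2l.
  by apply: le_trans h4 _; rewrite (mulrC 2) -mulrA ler_pM2l.
have {}He q : `|chart z z - q| < e -> (chart z @` dom z) q /\
    forall v, mnorm G z q v <= (2 * C) * `|v| /\ `|v| <= (2 * C) * mnorm G z q v.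
  by move=> h; apply: He; rewrite -ball_normE.
have CC : 0 < 2 * C by rewrite mulr_gt0.
exists (2 * C), (e / 3); split => //; first by rewrite divr_gt0.
  by move=> q h; apply: (He q _).1; apply: lt_trans h _; lra.
move=> P Q hP hQ; split.
  apply: (@segment_length z P Q _ e (chart z z)); rewrite ?(ltW CC) //.
  - by move=> q /He[zq H]; split => // v; exact: (H v).1.
  - by apply: lt_trans hP _; lra.
  - by apply: lt_trans hQ _; lra.
rewrite -lee_pdivrMl //; apply/ereal_infP => _ [c [Cc c0 c1] <-].
rewrite lee_pdivrMl //.
have e3 : e / 3 < e by lra.
have [/cod_chartK[zP PE] _] := He P (lt_trans hP e3).
have [/cod_chartK[zQ QE] _] := He Q (lt_trans hQ e3).
have PQ : `|Q - P| < 2 * e / 3.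
  rewrite -[Q - P](subrKA (chart z z)); apply: le_lt_trans (ler_normD _ _) _.
  by rewrite (distrC Q); lra.
have [lt|ge] := ltP ((2 * C)%:E * curve_length G c)%E (2 * e / 3)%:E.
  have HP q : `|q - P| < 2 * e / 3 -> (chart z @` dom z) q /\
      forall v, `|v| <= 2 * C * mnorm G z q v.
    move=> hq; have [|zq H] := He q; last by split => // v; exact: (H v).2.
    rewrite -(subrKA P); apply: le_lt_trans (ler_normD _ _) _.
    by rewrite (distrC P); lra.
  have r0 : 0 < 2 * e / 3 by lra.
  rewrite -c0 in zP PE.
  have [_] := chart_confine CC r0 Cc HP zP PE lt.
  by rewrite c1 QE distrC.
by apply: le_trans ge; rewrite lee_fin distrC ltW.
Qed.

End Lengths.

(** * Linear maps and their perturbations *)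

Section LinearBounds.
Variable R : realType.

Lemma linear_rV_bounded (W : normedModType R) m (A : {linear 'rV[R]_m -> W}) :
  exists2 C : R, 0 < C & forall w, `|A w| <= C * `|w|.
Proof.
exists (1 + \sum_i `|A (delta_mx 0 i)|).
  by rewrite ltr_pwDl // sumr_ge0.
move=> w; rewrite (linear_rV_sum A); apply: le_trans (ler_norm_sum _ _ _) _.
rewrite mulrDl mul1r mulr_suml -[leLHS]add0r lerD //.
by apply: ler_sum => i _; rewrite normrZ mulrC ler_wpM2l ?coord_le_norm.
Qed.

Lemma linear_rV_inj_bound m n (A : {linear 'rV[R]_m -> 'rV[R]_n}) :
  (forall w, A w = 0 -> w = 0) ->
  exists2 C : R, 0 < C & forall w, `|w| <= C * `|A w|.
Proof.
move=> A0; pose B := lin1_mx A.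
have fB : row_free B.
  by apply: inj_row_free => v; rewrite mul_rV_lin1 => /A0.
have [C C0 HC] := linear_rV_bounded (mulmxr (pinvmx B) : {linear 'rV[R]_n -> 'rV[R]_m}).
exists C => // w; have := HC (A w).
by rewrite /= -mul_rV_lin1 (mulmxKp fB).
Qed.

Lemma norm_split (W : normedModType R) (a b c : W) (e n : R) :
  `|a - b| <= e / 2 * n -> `|b - c| <= e / 2 * n -> `|a - c| <= e * n.
Proof.
move=> ab bc; rewrite -(subrKA b); apply: le_trans (ler_normD _ _) _.
by rewrite (splitr e) mulrDl lerD.
Qed.

Lemma norm_congr (W : normedModType R) (a a' b b' : W) (e : R) :
  a = a' -> b = b' -> `|a' - b'| <= e -> `|a - b| <= e.
Proof. by move=> -> ->. Qed.

(** Composites of linear maps are close when the factors are; the constants are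
    chosen so that each of the two errors is at most half of eta. *)
Lemma linear_comp_perturb (U V W : normedModType R) (A B : {linear V -> W})
    (T S : {linear U -> V}) (L L' eta delta d1 : R) :
  0 < L -> 0 < L' -> 0 < eta -> d1 = eta / (2 * (L' + 1)) ->
  delta <= 1 -> delta <= eta / (2 * L) ->
  (forall w, `|B w| <= L * `|w|) -> (forall w, `|S w| <= L' * `|w|) ->
  (forall w, `|A w - B w| <= d1 * `|w|) ->
  (forall w, `|T w - S w| <= delta * `|w|) ->
  forall w, `|A (T w) - B (S w)| <= eta * `|w|.
Proof.
move=> L0 L'0 eta0 d1E dl1 dle HL HL' Hg Hw w.
have d10 : 0 < d1 by rewrite d1E divr_gt0 // mulr_gt0 // addr_gt0.
apply: (@norm_split _ _ (B (T w))).
  apply: le_trans (Hg _) _.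
  apply: (@le_trans _ _ (d1 * ((L' + 1) * `|w|))).
    rewrite ler_pM2l // -[T w](subrK (S w)) mulrDl mul1r addrC.
    apply: le_trans (ler_normD _ _) _; rewrite lerD ?HL' //.
    by apply: le_trans (Hw _) _; rewrite ler_piMl.
  rewrite le_eqVlt d1E; apply/orP; left; apply/eqP; field; lra.
rewrite -linearB; apply: le_trans (HL _) _.
apply: (@le_trans _ _ (L * (eta / (2 * L) * `|w|))).
  rewrite ler_pM2l //; apply: le_trans (Hw _) _; exact: ler_wpM2r.
rewrite le_eqVlt; apply/orP; left; apply/eqP; field; lra.
Qed.

(** A factor a > 1 has to be shared between three approximations. *)
Lemma cube_root_above1 (a : R) : 1 < a -> exists2 s : R, 1 < s & s * s * s <= a.
Proof.
move=> a1; pose t := Num.min 1 ((a - 1) / 7).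
have t0 : 0 < t by rewrite lt_min ltr01 /=; lra.
have t1 : t <= 1 by rewrite ge_min lexx.
have ta : t <= (a - 1) / 7 by rewrite ge_min lexx orbT.
exists (1 + t); first lra.
nra.
Qed.

(** The arithmetic of [disc_linearize]: b is the norm of the difference of two
    image points, t the norm of the image of the tangent vector, w the norm of
    the difference of the coordinates; n0, ny, A are the norms of the linear
    approximations through which b and t are compared. *)
Lemma linearize_bounds (s a C1 C2 C3 b t ny n0 A w : R) :
  0 < s -> s * s * s <= a -> 0 < C1 -> 0 < C2 -> 0 < C3 ->
  0 <= b -> 0 <= t -> 0 <= w ->
  w <= C1 * A -> b <= s * n0 -> n0 <= s * b -> ny <= s * n0 -> n0 <= s * ny ->
  n0 <= C3 * A -> A <= C3 * n0 -> A <= C2 * w -> t <= s * ny -> ny <= s * t ->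
  [/\ b <= a * t, t <= a * b, b <= s * (C2 + C1) * C3 * w &
      w <= s * (C2 + C1) * C3 * b].
Proof.
move=> s0 sa C10 C20 C30 b0 t0 w0 w1 b1 b2 c1 c2 f1 f2 g d1 d2; split.
- apply: le_trans b1 _; apply: (@le_trans _ _ (s * (s * (s * t)))).
    by rewrite ler_pM2l //; apply: le_trans c2 _; rewrite ler_pM2l.
  by rewrite !mulrA ler_wpM2r.
- apply: le_trans d1 _; apply: (@le_trans _ _ (s * (s * (s * b)))).
    by rewrite ler_pM2l //; apply: le_trans c1 _; rewrite ler_pM2l.
  by rewrite !mulrA ler_wpM2r.
- apply: le_trans b1 _; rewrite -!mulrA ler_pM2l //.
  apply: le_trans f1 _; rewrite [leRHS]mulrCA ler_pM2l //.
  by apply: le_trans g _; rewrite ler_wpM2r // lerDl ltW.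
- apply: le_trans w1 _; apply: (@le_trans _ _ (C1 * (C3 * (s * b)))).
    by rewrite ler_pM2l //; apply: le_trans f2 _; rewrite ler_pM2l.
  rewrite (_ : C1 * (C3 * (s * b)) = s * C1 * C3 * b); last by ring.
  rewrite ler_wpM2r // ler_wpM2r ?(ltW C30) // ler_wpM2l ?(ltW s0) //.
  by rewrite lerDr ltW.
Qed.

End LinearBounds.

Lemma near_withinI (T : topologicalType) (x : T) (A B P : set T) :
  (\forall y \near within (A `&` B) (nbhs x), P y) ->
  \forall y \near within A (nbhs x), B y -> P y.
Proof.
by rewrite !near_withinE => H; apply: filterS H => y h Ay By; exact: h.
Qed.

(** * Linearization of the discs near a point *)

Section Discs.
Variables (R : realType) (d : nat) (M : manifold R d) (G : riemannian M).
Local Notation vec := 'rV[R]_d.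
Implicit Types (x y z : M).
Variables (X : set M) (E : M -> {vspace vec}) (th : disc_family M).
Hypothesis thX : tangent_disc_family X E th.
Hypothesis dimX : forall x0, X x0 ->
  \forall y \near within X (nbhs x0), \dim (E y) = \dim (E x0).

Lemma eball0 m (e : R) : 0 < e -> @eball R m e 0.
Proof.
by move=> e0; rewrite /eball /= big1 ?sqrtr0 // => i _; rewrite mxE expr0n.
Qed.

Lemma eball_norm m (e : R) u : @eball R m e u -> `|u| < e.
Proof.
rewrite /eball /= => h.
have e0 : 0 < e by apply: le_lt_trans h; exact: sqrtr_ge0.
apply: norm_lt_coord => // i; apply: le_lt_trans h.
rewrite -sqrtr_sqr ler_sqrt ?sumr_ge0 // => [|j _]; last exact: sqr_ge0.
by rewrite (bigD1 i) //= lerDl sumr_ge0 // => j _; exact: sqr_ge0.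
Qed.

(** The Euclidean norm is at most sqrt m times the sup norm; m.+1 is a crude value
    of the factor, positive also for m = 0. *)
Lemma norm_eball m (e : R) (u : 'rV[R]_m) : 0 < e -> `|u| < e / m.+1%:R -> @eball R m e u.
Proof.
move=> e0 h; rewrite /eball /= -[ltRHS](ger0_norm (ltW e0)) -sqrtr_sqr.
rewrite ltr_sqrt ?exprn_gt0 //.
have h2 : `|u| ^+ 2 < (e / m.+1%:R) ^+ 2.
  by rewrite ltr_pXn2r ?nnegrE // divr_ge0 // ltW.
apply: (@le_lt_trans _ _ (\sum_(i < m) `|u| ^+ 2)).
  by apply: ler_sum => i _; rewrite -[leLHS]real_normK ?num_real // ler_pXn2r ?nnegrE ?coord_le_norm.
rewrite sumr_const card_ord -mulr_natr.
apply: (@le_lt_trans _ _ (`|u| ^+ 2 * m.+1%:R)).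
  by rewrite ler_wpM2l ?exprn_ge0 // ler_nat leqnSn.
rewrite -ltr_pdivlMr //; apply: lt_le_trans h2 _.
rewrite exprMn ler_pM2l ?exprn_gt0 // exprVn lef_pV2 ?posrE ?exprn_gt0 //.
by rewrite expr2 ler_peMl // ler1n.
Qed.

Lemma disc_C1M y (m : nat) (u : 'rV[R]_m) : X y -> \dim (E y) = m -> `|u| < m.+1%:R^-1 ->
  C1M (th (m := m) y) u.
Proof.
move=> Xy Em hu; subst m; have [[Cy _ _ _] _ _] := thX.1 y Xy.
apply: C1into_C1M Cy; apply/nbhs_ballP.
exists (((\dim (E y)).+1)%:R^-1 - `|u|) => /=; first by rewrite subr_gt0.
move=> v; rewrite -ball_normE /= distrC => h; apply: norm_eball => //.
rewrite mul1r -[v](subrK u); apply: le_lt_trans (ler_normD _ _) _.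
by rewrite -ltrBrDr.
Qed.

Lemma disc_center y (m : nat) : X y -> \dim (E y) = m -> th (m := m) y 0 = y.
Proof. by move=> Xy <-; have [_ + _] := thX.1 y Xy. Qed.

Lemma disc_tangent_inj y (m : nat) (w : 'rV[R]_m) : X y -> \dim (E y) = m ->
  tangent (th (m := m) y) 0 w = 0 -> w = 0.
Proof.
move=> Xy Em h; subst m; have [[_ inj _ _] _ _] := thX.1 y Xy.
by apply: (inj 0 (eball0 _ ltr01)); rewrite h /tangent linear0.
Qed.

Lemma disc_tangent_in y (m : nat) (w : 'rV[R]_m) : X y -> \dim (E y) = m ->
  tangent (th (m := m) y) 0 w \in E y.
Proof.
move=> Xy Em; subst m; have [_ _ EE] := thX.1 y Xy.
have : tangent (th y) 0 w \in limg (linfun (tangent (th (m := \dim (E y)) y) 0)).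
  by rewrite /tangent -[X in X \in _]lfunE memv_img ?memvf.
by rewrite EE.
Qed.

(** C^1 continuity of the family of discs: on a closed ball that does not depend
    on y, the disc at y is C^1-close to the linearization at 0 of the disc at y0. *)
Lemma disc_chart_near y0 (delta : R) : X y0 -> 0 < delta ->
  let m := \dim (E y0) in
  exists2 rho : R, 0 < rho < m.+1%:R^-1 &
  \forall y \near within X (nbhs y0), \dim (E y) = m /\
    forall u, `|u| <= rho ->
    [/\ C1M (th (m := m) y) u, dom y0 (th y u),
      `|chart y0 (th y u) - chart y0 y0| < delta &
      forall w, `|'d (chart y0 \o th y) u w - 'd (chart y0 \o th (m := m) y0) 0 w|
        <= delta * `|w|].
Proof.
move=> X0 d0 m; have zz := dom_center y0.
have m0 : 0 < m.+1%:R^-1 :> R by rewrite invr_gt0.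
have th0 : th (m := m) y0 0 = y0 by exact: disc_center.
have Cth : C1M (th (m := m) y0) 0 by apply: disc_C1M => //; rewrite normr0.
have zth : dom y0 (th (m := m) y0 0) by rewrite th0.
have d2 : 0 < delta / 2 by rewrite divr_gt0.
have Cch := C1M_chart Cth zth.
have /nbhs_ballP[r /= r0 Hr] : nbhs (0 : 'rV[R]_m) (fun u =>
    [/\ dom y0 (th y0 u), `|chart y0 (th y0 u) - chart y0 y0| < delta / 2 &
      forall w, `|'d (chart y0 \o th y0) u w - 'd (chart y0 \o th (m := m) y0) 0 w|
        <= delta / 2 * `|w|]).
  have n1 := near_dom Cth.1 zth.
  have cch := differentiable_continuous (C1at_diff Cch).
  have /cvgrPdistC_lt/(_ _ d2) n2 := cch.
  have n3 := C1at_near_op d2 Cch.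
  apply: filterS3 n1 n2 n3 => u h1 h2 [_ h3]; split => //.
  by move: h2; rewrite /= th0.
pose rho := Num.min (r / 2) (m.+1%:R^-1 / 2).
have rho0 : 0 < rho by rewrite lt_min !divr_gt0.
have rhor : rho < r by rewrite gt_min; apply/orP; left; lra.
have rhom : rho < m.+1%:R^-1 by rewrite gt_min; apply/orP; right; rewrite ltr_pdivrMr // ltr_pMr // ltr1n.
exists rho; first by rewrite rho0.
pose Q := [set u : 'rV[R]_m | `|u| <= rho].
have cQ : compact Q.
  apply: bounded_closed_compact.
    exists rho; split; first exact: num_real.
    by move=> a ha q /= h; apply: le_trans h (ltW ha).
  have -> : Q = closed_ball_ Num.norm 0 rho.
    by apply/seteqP; split => q; rewrite /Q /closed_ball_ /= sub0r normrN.
  exact: closed_closed_ball_.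
have QB u : Q u -> ball 0 r u.
  by move=> h; rewrite -ball_normE /= sub0r normrN; exact: le_lt_trans h rhor.
have Qe : Q `<=` @eball R m 1.
  by move=> u h; apply: norm_eball => //; rewrite mul1r; exact: le_lt_trans h rhom.
have Qdom : th (m := m) y0 @` Q `<=` dom y0.
  by move=> _ [u /QB/Hr[h _ _] <-].
have H := thX.2 m y0 X0 erefl y0 Q (delta / 2) cQ Qe Qdom d2.
have {}H : \forall y \near within X (nbhs y0), \dim (E y) = m ->
   th (m := m) y @` Q `<=` dom y0 /\
      forall v, Q v -> `|chart y0 (th y v) - chart y0 (th y0 v)| < delta / 2 /\
        forall w, `|'d (chart y0 \o th y) v w - 'd (chart y0 \o th (m := m) y0) v w|
                  <= delta / 2 * `|w|.
  exact: near_withinI H.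
have HX : \forall y \near within X (nbhs y0), X y by exact: withinT.
apply: filterS3 (dimX X0) H HX => y Ey /(_ Ey) [h1 h2] Xy.
split; first exact: Ey.
move=> u hu.
have [k1 k2] := h2 u hu; have [l1 l2 l3] := Hr u (QB u hu).
split.
- by apply: disc_C1M => //; exact: le_lt_trans hu rhom.
- by apply: h1; exists u.
- rewrite -(subrKA (chart y0 (th y0 u))); apply: le_lt_trans (ler_normD _ _) _.
  by rewrite (splitr delta) ltrD.
- move=> w; exact: (norm_split (k2 w) (l3 w)).
Qed.

(** The same for the composite of the discs with a C^1 map h. *)
Lemma disc_map_chart_near (h : M -> M) y0 (eta : R) (V : set M) :
  X y0 -> C1map h -> 0 < eta -> nbhs (h y0) V ->
  let m := \dim (E y0) in
  exists2 rho : R, 0 < rho < m.+1%:R^-1 &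
  \forall y \near within X (nbhs y0), \dim (E y) = m /\
    forall u, `|u| <= rho ->
    [/\ V (h (th (m := m) y u)), dom (h y0) (h (th (m := m) y u)),
       differentiable (chart (h y0) \o (h \o th (m := m) y)) u &
       forall w, `|'d (chart (h y0) \o (h \o th (m := m) y)) u w -
            'd (chart (h y0) \o (h \o th (m := m) y0)) 0 w| <= eta * `|w|].
Proof.
move=> X0 Ch eta0 nV m; set z := h y0.
have zz := dom_center y0.
have Cg : C1at (chart z \o (h \o param y0)) (chart y0 y0).
  apply: C1M_chart; first exact: C1map_C1M.
  by rewrite /= chartK //; exact: dom_center.
set g := chart z \o (h \o param y0) in Cg; set p0 := chart y0 y0 in Cg.
have [L L0 HL] := linear_rV_bounded ('d g p0).
have [L' L'0 HL'] := linear_rV_bounded ('d (chart y0 \o th (m := m) y0) 0).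
pose d1 := eta / (2 * (L' + 1)).
have d10 : 0 < d1 by rewrite divr_gt0 // mulr_gt0 // addr_gt0.
have /nbhs_ballP[r /= r0 Hr] : nbhs p0 (fun p => [/\ V (h (param y0 p)),
    dom z (h (param y0 p)), differentiable g p &
    forall w, `|'d g p w - 'd g p0 w| <= d1 * `|w|]).
  have chp : {for p0, continuous (h \o param y0)} by have [] := C1map_C1M Ch zz.
  have E0 : (h \o param y0) p0 = z by rewrite /= chartK.
  have n1 : nbhs p0 (fun p => V (h (param y0 p))).
    by apply: chp; rewrite E0.
  have n2 : nbhs p0 (fun p => dom z (h (param y0 p))).
    by apply: chp; rewrite E0; apply: nbhs_dom; exact: dom_center.
  by apply: filterS3 n1 n2 (C1at_near_op d10 Cg) => p h1 h2 [h3 h4]; split.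
(* With delta <= r the image of the disc lies in the domain of the estimate for g. *)
pose delta := Num.min (Num.min 1 r) (eta / (2 * L)).
have delta0 : 0 < delta by rewrite !lt_min ltr01 r0 /= divr_gt0 // mulr_gt0.
have dl1 : delta <= 1 by rewrite !ge_min lexx.
have dlr : delta <= r by rewrite !ge_min lexx orbT.
have dle : delta <= eta / (2 * L) by rewrite ge_min lexx orbT.
have [rho rho0 H] := disc_chart_near X0 delta0.
exists rho => //.
have key y : (forall u, `|u| <= rho ->
    [/\ C1M (th (m := m) y) u, dom y0 (th y u),
      `|chart y0 (th y u) - chart y0 y0| < delta &
      forall w, `|'d (chart y0 \o th y) u w - 'd (chart y0 \o th (m := m) y0) 0 w|
        <= delta * `|w|]) -> forall u, `|u| <= rho ->
     [/\ V (h (th (m := m) y u)), dom z (h (th (m := m) y u)),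
       differentiable (chart z \o (h \o th (m := m) y)) u &
       forall w, 'd (chart z \o (h \o th (m := m) y)) u w =
         'd g (chart y0 (th (m := m) y u)) ('d (chart y0 \o th (m := m) y) u w) /\
         forall w, `|'d g (chart y0 (th (m := m) y u)) w - 'd g p0 w| <= d1 * `|w|].
  move=> Hy u hu; have [Cu yu clu _] := Hy u hu.
  have [] := Hr (chart y0 (th y u)).
    by rewrite -ball_normE /= distrC; exact: lt_le_trans clu dlr.
  rewrite (chartK yu) => Vu du dg Hg.
  split; [exact: Vu|exact: du| |].
    exact: (C1at_diff (C1M_chart (C1M_comp Ch Cu) du)).
  move=> w; split; last exact: Hg.
  have nE : \forall q \near u, g ((chart y0 \o th (m := m) y) q) =
      (chart z \o (h \o th (m := m) y)) q.
    by apply: filterS (near_dom Cu.1 yu) => q yq; rewrite /g /= chartK.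
  exact: (near_diff_comp (erefl _) nE (C1at_diff (C1M_chart Cu yu)) dg w).
have [_ H0] : \dim (E y0) = m /\ (forall u, `|u| <= rho ->
    [/\ C1M (th (m := m) y0) u, dom y0 (th y0 u),
      `|chart y0 (th y0 u) - chart y0 y0| < delta &
      forall w, `|'d (chart y0 \o th y0) u w - 'd (chart y0 \o th (m := m) y0) 0 w|
        <= delta * `|w|]).
  by apply: (nbhs_singleton (H : nbhs y0 _)) X0.
have [rp rm] := andP rho0.
have [|_ _ _ E0] := key y0 H0 0; first by rewrite normr0 ltW.
have E00 : chart y0 (th (m := m) y0 0) = p0 by rewrite (disc_center X0 erefl).
rewrite E00 in E0.
apply: filterS H => y [Em Hy]; split; first exact: Em.
move=> u hu; have [Vu du dg Eu] := key y Hy u hu.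
split; [exact: Vu|exact: du|exact: dg|move=> w].
have [Ew Hg] := Eu w; have [E0w _] := E0 w.
have [_ _ _ Hw] := Hy u hu.
exact: (norm_congr Ew E0w
  (linear_comp_perturb L0 L'0 eta0 (erefl d1) dl1 dle HL HL' Hg Hw w)).
Qed.

(** In the chart at h y0 the difference of the images under h of two points of
    the disc at y is, up to a factor a close to 1, the image under the tangent
    maps of the difference of their coordinates, for all y of X near y0.  Both
    are compared with A y0 (u - v), where A y0 is the differential at 0 of
    h o th_y0 in this chart, which is injective.  The case h = id describes the
    discs themselves. *)
Lemma disc_linearize (h : M -> M) y0 (a : R) (V : set M) :
  X y0 -> C1map h -> (forall v, D h y0 v = 0 -> v = 0) -> 1 < a ->
  nbhs (h y0) V ->
  let m := \dim (E y0) in let z := h y0 in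
  exists C rho : R, [/\ 0 < C, 0 < rho &
  \forall y \near within X (nbhs y0), \dim (E y) = m /\
    forall u v : 'rV[R]_m, `|u| <= rho -> `|v| <= rho ->
    let b := chart z (h (th y u)) - chart z (h (th y v)) in
    let t := D h y (tangent (th (m := m) y) 0 (u - v)) in
    [/\ V (h (th y u)), rnorm G z b <= a * rnorm G (h y) t,
       rnorm G (h y) t <= a * rnorm G z b,
       rnorm G z b <= C * `|u - v| & `|u - v| <= C * rnorm G z b]].
Proof.
move=> X0 Ch inj a1 nV m z.
have m0 : 0 < m.+1%:R^-1 :> R by rewrite invr_gt0.
have zz : dom z z := dom_center z.
have Cth y : X y -> \dim (E y) = m -> C1M (th (m := m) y) 0.
  by move=> Xy Ey; apply: disc_C1M => //; rewrite normr0.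
pose A y := 'd (chart z \o (h \o th (m := m) y)) 0.
have AE y w : X y -> \dim (E y) = m -> dom z (h y) ->
    rnorm G (h y) (D h y (tangent (th (m := m) y) 0 w)) =
    mnorm G z (chart z (h y)) (A y w).
  move=> Xy Ey zy; have thy := disc_center Xy Ey.
  have C2 := C1M_comp Ch (Cth y Xy Ey).
  have zy' : dom z ((h \o th (m := m) y) 0) by rewrite /= thy.
  have := tangent_chart w C2 zy'.
  have := tangent_comp w Ch (Cth y Xy Ey).
  rewrite /= thy => -> E2; rewrite E2 /mnorm chartK //.
have A0inj w : A y0 w = 0 -> w = 0.
  move=> Aw; have := AE y0 w X0 erefl zz; rewrite Aw mnorm_chart rnorm0.
  have [C [C1 HC]] := rnorm_equiv G (h y0).
  move=> r0; have := (HC (D h y0 (tangent (th (m := m) y0) 0 w))).2.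
  rewrite r0 mulr0 normr_le0 => /eqP/inj; exact: (disc_tangent_inj X0 erefl).
have [C1 C10 HC1] := linear_rV_inj_bound A0inj.
have [C2 C20 HC2] := linear_rV_bounded (A y0).
have [C3 [C31 HC3]] := rnorm_equiv G z.
have C30 : 0 < C3 by apply: lt_le_trans C31.
have [s s1 sa] := cube_root_above1 a1.
have s0 : 0 < s by apply: lt_trans s1.
have [eta eta0 Heta] := rnorm_perturb G z s1.
have e0 : 0 < eta / C1 by rewrite divr_gt0.
have [rho /andP[rho0 rhom] H] := disc_map_chart_near X0 Ch e0 nV.
exists (s * (C2 + C1) * C3), rho; split => //.
  by rewrite !mulr_gt0 // addr_gt0.
have HX : \forall y \near within X (nbhs y0), X y by exact: withinT.
have nm : \forall y \near within X (nbhs y0), dom z (h y) /\ forall v,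
    mnorm G z (chart z (h y)) v <= s * rnorm G z v /\
    rnorm G z v <= s * mnorm G z (chart z (h y)) v.
  apply: cvg_within.
  have ch := C1map_continuous Ch (x := y0).
  have n1 : \forall y \near y0, dom z (h y) := ch _ (nbhs_dom zz).
  have n2 : \forall y \near y0, forall v,
    mnorm G z (chart z (h y)) v <= s * rnorm G z v /\
    rnorm G z v <= s * mnorm G z (chart z (h y)) v.
    exact: (cvg_comp _ _ ch (chart_continuous zz) _ (mnorm_near G z s1)).
  by apply: filterS2 n1 n2.
apply: filterS3 HX H nm => y Xy [Ey Hy] [zy Hm]; split; first exact: Ey.
move=> u v hu hv; set w := u - v.
set b := chart z (h (th y u)) - _; set t := D h y _.
have [Vu zu _ _] := Hy u hu.
have w1 : `|w| <= C1 * `|A y0 w| := HC1 w.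
have lin (c : vec) : `|c - A y0 w| <= eta / C1 * `|w| ->
    rnorm G z c <= s * rnorm G z (A y0 w) /\ rnorm G z (A y0 w) <= s * rnorm G z c.
  move=> hc; apply: Heta; apply: le_trans hc _.
  apply: (@le_trans _ _ (eta / C1 * (C1 * `|A y0 w|))).
    by rewrite ler_wpM2l // ltW.
  by rewrite mulrA divfK // gt_eqF.
have [b1 b2] : rnorm G z b <= s * rnorm G z (A y0 w) /\
    rnorm G z (A y0 w) <= s * rnorm G z b.
  apply: lin; apply: (@mean_value _ _ _ (chart z \o (h \o th (m := m) y)) (A y0) u v); first exact: ltW.
  move=> q /andP[q0 q1].
  have hq : `|v + q *: (u - v)| <= rho.
    have -> : v + q *: (u - v) = q *: u + (1 - q) *: v.
      by apply/rowP => i; rewrite !mxE; ring.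
    apply: le_trans (ler_normD _ _) _; rewrite !normrZ !ger0_norm ?subr_ge0 //.
    nra.
  have [_ _ k1 k2] := Hy _ hq; split; [exact: k1|exact: k2].
have [c1 c2] : rnorm G z (A y w) <= s * rnorm G z (A y0 w) /\
    rnorm G z (A y0 w) <= s * rnorm G z (A y w).
  by apply: lin; have [|_ _ _ k] := Hy 0; [rewrite normr0 ltW|exact: k].
have tE : rnorm G (h y) t = mnorm G z (chart z (h y)) (A y w) by exact: AE.
have [d1 d2] := Hm (A y w).
have [f1 f2] := HC3 (A y0 w).
have g := HC2 w.
have nb : 0 <= rnorm G z b := rnorm_ge0 G z b.
have nt : 0 <= rnorm G (h y) t := rnorm_ge0 G _ _.
rewrite -tE in d1 d2.
have [r1 r2 r3 r4] := linearize_bounds s0 sa C10 C20 C30 nb nt (normr_ge0 w)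
  w1 b1 b2 c1 c2 f1 f2 g d1 d2.
split; [exact: Vu|exact: r1|exact: r2|exact: r3|exact: r4].
Qed.

End Discs.

(** * Uniformity over a compact set *)

(** A size r that is valid near each point of a compact set, and that may be
    decreased, can be chosen uniformly. *)
Lemma compact_uniform (R : realType) (T : topologicalType) (X : set T)
    (P : T -> R -> Prop) : compact X ->
  (forall y r r', P y r -> 0 < r' <= r -> P y r') ->
  (forall y0, X y0 -> exists2 r, 0 < r &
     \forall y \near within X (nbhs y0), P y r) ->
  exists2 r, 0 < r & forall y, X y -> P y r.
Proof.
move=> /compact_near_coveringP cX mono loc.
have H : \forall r \near 0^'+, X `<=` (fun y => P y r).
  suff H : \forall r \near 0^'+, X `<=` (fun y => X y -> P y r).
    by apply: filterS H => r Hr y Xy; exact: Hr.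
  apply: (cX R 0^'+ (fun r y => X y -> P y r)) => y0 Xy0.
  have [r r0 Hr] := loc y0 Xy0.
  exists ([set y | X y -> P y r], [set r' | 0 < r' <= r]); first split => /=.
  - by rewrite near_withinE in Hr; exact: Hr.
  - near=> r' => /=; apply/andP; split; near: r'; [exact: nbhs_right_gt|exact: nbhs_right_le].
  move=> [y r'] /= [Hy hr'] Xy; exact: (mono y r r' (Hy Xy) hr').
have H0 : \forall r \near (0 : R)^'+, 0 < r by exact: nbhs_right_gt.
have [r [r0 Hr]] := filter_ex (filterI H0 H).
by exists r.
Unshelve. all: by end_near. Qed.

Lemma near_within_comp (T : topologicalType) (X P : set T) (h : T -> T) (x : T) :
  {for x, continuous h} -> (forall y, X y -> X (h y)) ->
  (\forall z \near within X (nbhs (h x)), P z) ->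
  \forall y \near within X (nbhs x), P (h y).
Proof.
move=> ch hX; rewrite !near_withinE => H.
have {}H : nbhs x (fun y => X (h y) -> P (h y)) := ch _ H.
by apply: filterS H => y Hy Xy; exact: Hy (hX _ Xy).
Qed.

(** The arithmetic of [disc_metric_uniform]: D is the distance of the two points,
    b and N the coordinate norm and the Riemannian norm of their difference in
    a chart, n and w the norms |u - v|_y and |u - v|. *)
Lemma metric_bounds (R : realType) (C C2 C3 r n N b w : R) (D : \bar R) :
  0 < C -> 0 < C2 -> 0 < C3 -> 2 * C * C2 + 2 * C3 <= r ->
  0 <= n -> 0 <= N -> 0 <= w -> (0 <= D)%E ->
  (D <= (C * b)%:E)%E -> (b%:E <= C%:E * D)%E ->
  N <= C2 * b -> b <= C2 * N -> N <= 2 * n -> n <= 2 * N ->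
  N <= C3 * w -> w <= C3 * N ->
  [/\ (D <= (r * n)%:E)%E, (n%:E <= r%:E * D)%E, w <= r * n & n <= r * w].
Proof.
move=> C0 C20 C30 rB n0 N0 w0 D0 d1 d2 f1 f2 k1 k2 k3 k4.
have B1 : 2 * C * C2 <= r by apply: le_trans rB; rewrite lerDl mulr_ge0 ?ltW.
have B2 : 2 * C3 <= r by apply: le_trans rB; rewrite lerDr !mulr_ge0 ?ltW.
split.
- apply: le_trans d1 _; rewrite lee_fin.
  apply: (@le_trans _ _ (C * (C2 * (2 * n)))).
    by rewrite ler_pM2l //; apply: le_trans f2 _; rewrite ler_pM2l.
  rewrite (_ : C * (C2 * (2 * n)) = 2 * C * C2 * n); last by ring.
  by rewrite ler_wpM2r.
- have : (n%:E <= (2 * C2)%:E * b%:E)%E.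
    by rewrite -EFinM lee_fin; apply: le_trans k2 _; rewrite -mulrA ler_pM2l.
  move/le_trans; apply; apply: (@le_trans _ _ ((2 * C2)%:E * (C%:E * D))%E).
    by apply: lee_wpmul2l => //; rewrite lee_fin mulr_ge0 ?ltW.
  rewrite muleA -EFinM; apply: lee_wpmul2r => //; rewrite lee_fin.
  by apply: le_trans B1; rewrite mulrAC.
- apply: le_trans k4 _; apply: (@le_trans _ _ (C3 * (2 * n))).
    by rewrite ler_pM2l.
  by rewrite mulrA (mulrC C3) ler_wpM2r.
- apply: le_trans k2 _; apply: (@le_trans _ _ (2 * (C3 * w))).
    by rewrite ler_pM2l.
  by rewrite mulrA ler_wpM2r.
Qed.

Section Uniform.
Variables (R : realType) (d : nat) (M : manifold R d) (G : riemannian M).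
Local Notation vec := 'rV[R]_d.
Implicit Types (x y z : M).
Variables (X : set M) (E : M -> {vspace vec}) (th : disc_family M).
Hypothesis cX : compact X.
Hypothesis thX : tangent_disc_family X E th.
Hypothesis dimX : forall x0, X x0 ->
  \forall y \near within X (nbhs x0), \dim (E y) = \dim (E x0).

(** The Riemannian norm of the tangent vector to the disc at y with disc
    coordinates w.  A step of the dynamics changes it like the norm of a vector
    tangent at the center, up to a factor close to 1, whereas a fixed norm on the
    coordinates would cost a multiplicative constant at every step. *)
Definition disc_norm (m : nat) y (w : 'rV[R]_m) : R :=
  rnorm G y (tangent (th (m := m) y) 0 w).

Lemma disc_norm_ge0 m y (w : 'rV[R]_m) : 0 <= disc_norm y w.
Proof. exact: rnorm_ge0. Qed.

Lemma D_id_inj y v : D (@id M) y v = 0 -> v = 0.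
Proof. by rewrite D_id. Qed.

(** One application of h contracts the differences of disc coordinates like the
    tangent map of h does on the tangent vectors at the center, up to the factor
    a.  The second, crude bound controls the finitely many iterates for which
    nothing is known about the norms. *)
Lemma disc_step_uniform (h : M -> M) (a : R) : C1map h ->
  (forall y v, D h y v = 0 -> v = 0) -> (forall y, X y -> X (h y)) -> 1 < a ->
  exists2 r : R, 0 < r & forall y, X y -> forall m m' (u v : 'rV[R]_m)
    (u' v' : 'rV[R]_m'), \dim (E y) = m -> \dim (E (h y)) = m' ->
    `|u| <= r -> `|v| <= r -> `|u'| <= r -> `|v'| <= r ->
    h (th y u) = th (h y) u' -> h (th y v) = th (h y) v' ->
    disc_norm (h y) (u' - v') <= a * rnorm G (h y) (D h y (tangent (th (m := m) y) 0 (u - v))) /\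
    disc_norm (h y) (u' - v') <= r^-1 * disc_norm y (u - v).
Proof.
move=> Ch inj hX a1.
pose P y r := forall m m' (u v : 'rV[R]_m)
    (u' v' : 'rV[R]_m'), \dim (E y) = m -> \dim (E (h y)) = m' ->
    `|u| <= r -> `|v| <= r -> `|u'| <= r -> `|v'| <= r ->
    h (th y u) = th (h y) u' -> h (th y v) = th (h y) v' ->
    disc_norm (h y) (u' - v') <= a * rnorm G (h y) (D h y (tangent (th (m := m) y) 0 (u - v))) /\
    disc_norm (h y) (u' - v') <= r^-1 * disc_norm y (u - v).
apply: (@compact_uniform _ _ _ P) => //.
  move=> y r r' Hr /andP[r'0 rr'] m m' u v u' v' Em Em' h1 h2 h3 h4 e1 e2.
  have [] := Hr m m' u v u' v' Em Em' (le_trans h1 rr') (le_trans h2 rr')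
    (le_trans h3 rr') (le_trans h4 rr') e1 e2.
  move=> k1 k2; split => //; apply: le_trans k2 _.
  by rewrite ler_wpM2r ?disc_norm_ge0 // lef_pV2 ?posrE // (lt_le_trans r'0).
move=> y0 X0.
have [s s1 sa] := cube_root_above1 a1.
have s0 : 0 < s by apply: lt_trans s1.
have [C [r [C0 r0 H]]] := disc_linearize G thX dimX X0 Ch (inj y0) s1 (filterT : nbhs (h y0) setT).
have [C' [r' [C'0 r'0 H']]] := disc_linearize G thX dimX X0 (@C1map_id _ _ M) (@D_id_inj y0) s1 (filterT : nbhs y0 setT).
have [C2 [r2 [C20 r20 H2]]] := disc_linearize G thX dimX (hX _ X0) (@C1map_id _ _ M) (@D_id_inj (h y0)) s1 (filterT : nbhs (h y0) setT).
pose B := s * C * (C' * s).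
have B0 : 0 < B by rewrite !mulr_gt0.
pose rho := Num.min (Num.min r r') (Num.min r2 B^-1).
exists rho; first by rewrite !lt_min r0 r'0 r20 invr_gt0.
have l1 : rho <= r by rewrite !ge_min lexx.
have l2 : rho <= r' by rewrite !ge_min lexx orbT.
have l3 : rho <= r2 by rewrite !ge_min lexx !orbT.
have l4 : rho <= B^-1 by rewrite !ge_min lexx !orbT.
have rho0 : 0 < rho by rewrite !lt_min r0 r'0 r20 invr_gt0.
have {}H2 : \forall y \near within X (nbhs y0), \dim (E (h y)) = \dim (E (h y0)) /\
  forall u v : 'rV[R]_(\dim (E (h y0))), `|u| <= r2 -> `|v| <= r2 ->
    let b := chart (h y0) (th (h y) u) - chart (h y0) (th (h y) v) in
    disc_norm (h y) (u - v) <= s * rnorm G (h y0) b.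
  have H2' := near_within_comp (C1map_continuous Ch (x := y0)) hX H2.
  apply: filterS H2' => y [Ey Hy]; split; first exact: Ey.
  move=> u v hu hv; have [_ _ k _ _] := Hy u v hu hv.
  by move: k; rewrite /= D_id.
apply: filterS3 H2 H H' => y [Ehy Hhy] [Ey Hy] [_ Hy'].
move=> m m' u v u' v' Em Em'.
have mE : m = \dim (E y0) by rewrite -Em.
have m'E : m' = \dim (E (h y0)) by rewrite -Em'.
clear Em Em'; subst m m' => hu hv hu' hv' eu ev.
have [_ k1 k2 k3 k4] := Hy u v (le_trans hu l1) (le_trans hv l1).
have [_ q1 q2 q3 q4] := Hy' u v (le_trans hu l2) (le_trans hv l2).
have := Hhy u' v' (le_trans hu' l3) (le_trans hv' l3).
rewrite /= D_id -/(disc_norm y (u - v)) in q1 q2.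
rewrite /= -eu -ev => p1.
set n1 := rnorm G (h y0) _ in k1 k2 k3 k4 p1.
set n2 := rnorm G (h y) _ in k1 k2 *.
have n20 : 0 <= n2 by exact: rnorm_ge0.
have n0 := disc_norm_ge0 y (u - v).
split.
  apply: le_trans p1 _; apply: (@le_trans _ _ (s * (s * n2))); first by rewrite ler_pM2l.
  rewrite mulrA ler_wpM2r //; apply: le_trans sa; rewrite -[leLHS]mulr1.
  by rewrite ler_wpM2l ?mulr_ge0 ?ltW.
apply: (@le_trans _ _ (B * disc_norm y (u - v))); last first.
  by rewrite ler_wpM2r // -[leLHS]invrK lef_pV2 ?posrE ?invr_gt0.
apply: le_trans p1 _; rewrite /B -!mulrA ler_pM2l //.
apply: le_trans k3 _; rewrite ler_pM2l //.
apply: le_trans q4 _; by rewrite ler_pM2l.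
Qed.

Lemma disc_metric_uniform : exists2 r : R, 0 < r &
  forall y, X y -> forall m (u v : 'rV[R]_m), \dim (E y) = m ->
    `|u| <= r -> `|v| <= r ->
    [/\ (rdist G (th y u) (th y v) <= (r^-1 * disc_norm y (u - v))%:E)%E,
        ((disc_norm y (u - v))%:E <= (r^-1)%:E * rdist G (th y u) (th y v))%E,
        `|u - v| <= r^-1 * disc_norm y (u - v) &
        disc_norm y (u - v) <= r^-1 * `|u - v|].
Proof.
pose P y r := forall m (u v : 'rV[R]_m), \dim (E y) = m ->
    `|u| <= r -> `|v| <= r ->
    [/\ (rdist G (th y u) (th y v) <= (r^-1 * disc_norm y (u - v))%:E)%E,
        ((disc_norm y (u - v))%:E <= (r^-1)%:E * rdist G (th y u) (th y v))%E,
        `|u - v| <= r^-1 * disc_norm y (u - v) &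
        disc_norm y (u - v) <= r^-1 * `|u - v|].
apply: (@compact_uniform _ _ _ P) => //.
  move=> y r r' Hr /andP[r'0 rr'] m u v Em hu hv.
  have [k1 k2 k3 k4] := Hr m u v Em (le_trans hu rr') (le_trans hv rr').
  have ir : r^-1 <= r'^-1 by rewrite lef_pV2 ?posrE // (lt_le_trans r'0).
  split.
  - by apply: le_trans k1 _; rewrite lee_fin ler_wpM2r ?disc_norm_ge0.
  - by apply: le_trans k2 _; apply: lee_wpmul2r; [exact: rdist_ge0|rewrite lee_fin].
  - by apply: le_trans k3 _; rewrite ler_wpM2r ?disc_norm_ge0.
  - by apply: le_trans k4 _; rewrite ler_wpM2r.
move=> y0 X0.
have [C [e [C0 e0 He Hd]]] := rdist_chart G y0.
have [C2 [C21 HC2]] := rnorm_equiv G y0.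
have C20 : 0 < C2 by apply: lt_le_trans C21.
have zz := dom_center y0.
pose V := [set p | dom y0 p /\ `|chart y0 y0 - chart y0 p| < e].
have nV : nbhs y0 V.
  have n1 : nbhs y0 (fun p => `|chart y0 y0 - chart y0 p| < e).
    have /cvgrPdist_lt/(_ _ e0) := chart_continuous zz; exact.
  by apply: filterS2 (nbhs_dom zz) n1.
have [C3 [r [C30 r0 H]]] := disc_linearize G thX dimX X0 (@C1map_id _ _ M) (@D_id_inj y0) (ltr1n R 2) nV.
pose B := 2 * C * C2 + 2 * C3.
have B0 : 0 < B by rewrite addr_gt0 // !mulr_gt0.
exists (Num.min r B^-1); first by rewrite lt_min r0 invr_gt0.
set rho := Num.min r B^-1.
have rho0 : 0 < rho by rewrite lt_min r0 invr_gt0.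
have rr : rho <= r by rewrite ge_min lexx.
have rB : B <= rho^-1.
  by rewrite -[leLHS]invrK lef_pV2 ?posrE ?invr_gt0 // ge_min lexx orbT.
apply: filterS H => y [Ey Hy] m u v Em.
have mE : m = \dim (E y0) by rewrite -Em.
clear Em; subst m => hu hv.
have [[du cu] k1 k2 k3 k4] := Hy u v (le_trans hu rr) (le_trans hv rr).
have [[dv cv] _ _ _ _] := Hy v u (le_trans hv rr) (le_trans hu rr).
rewrite /= D_id -/(disc_norm y (u - v)) in k1 k2.
have [d1 d2] := Hd _ _ cu cv; rewrite (chartK du) (chartK dv) in d1 d2.
rewrite /= in du cu dv cv k1 k2 k3 k4 d1 d2.
set b := chart y0 _ - _ in k1 k2 k3 k4 d1 d2.
have [f1 f2] := HC2 b.
set n := disc_norm y (u - v) in k1 k2 *.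
have n0 : 0 <= n by exact: disc_norm_ge0.
have nb : 0 <= rnorm G y0 b by exact: rnorm_ge0.
exact: (metric_bounds C0 C20 C30 rB n0 nb (normr_ge0 _) (rdist_ge0 _ _ _)
  d1 d2 f1 f2 k1 k2 k3 k4).
Qed.

End Uniform.

(** * Contraction of discs along an orbit *)

Section Dynamics.
Variables (R : realType) (d : nat) (M : manifold R d) (G : riemannian M).
Local Notation vec := 'rV[R]_d.
Implicit Types (x y z p q : M) (E : M -> {vspace vec}).

Lemma D_bounded (f : M -> M) x : exists2 C : R, 0 <= C &
  forall v, rnorm G (f x) (D f x v) <= C * rnorm G x v.
Proof.
have [C1 [C11 H1]] := rnorm_equiv G x.
have [C2 [C21 H2]] := rnorm_equiv G (f x).
have C10 : 0 < C1 by apply: lt_le_trans C11.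
have C20 : 0 < C2 by apply: lt_le_trans C21.
have [C C0 HC] : exists2 C : R, 0 < C & forall v, `|D f x v| <= C * `|v|.
  by rewrite /D /tangent; exact: linear_rV_bounded.
exists (C2 * C * C1); first by rewrite !mulr_ge0 // ltW.
move=> v; apply: le_trans (H2 _).1 _; rewrite -!mulrA ler_pM2l //.
by apply: le_trans (HC v) _; rewrite ler_pM2l // (H1 v).2.
Qed.

Lemma D_scale (f : M -> M) x (a : R) v : D f x (a *: v) = a *: D f x v.
Proof. by rewrite /D /tangent linearZ. Qed.

Lemma D0 (f : M -> M) x : D f x 0 = 0.
Proof. by rewrite /D /tangent linear0. Qed.

Lemma dnorm_nonneg f n E x : (0 <= dnorm G f n E x)%E.
Proof.
apply: ereal_sup_ubound; exists 0; last by rewrite D0 rnorm0.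
by split; [exact: mem0v|rewrite rnorm0 ler01].
Qed.

(** Operator norms are finite, so that conditions (a) and (b) can be turned into
    inequalities between real numbers. *)
Lemma dnorm_fin f n E x : dnorm G f n E x \is a fin_num.
Proof.
have [C C0 HC] := D_bounded (iter n f) x.
rewrite ge0_fin_numE ?dnorm_nonneg //; apply: (@le_lt_trans _ _ C%:E); last exact: ltry.
apply: ge_ereal_sup => _ [v [Ev v1] <-]; rewrite lee_fin.
by apply: le_trans (HC v) _; rewrite ler_piMr.
Qed.

Lemma rnorm_eq0 x v : rnorm G x v = 0 -> v = 0.
Proof.
have [C [_ H]] := rnorm_equiv G x => v0.
by have := (H v).2; rewrite v0 mulr0 normr_le0 => /eqP.
Qed.

Lemma dnorm_bound f n E x v : v \in E x ->
  rnorm G (iter n f x) (D (iter n f) x v) <= fine (dnorm G f n E x) * rnorm G x v.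
Proof.
move=> Ev; have [v0|v0] := eqVneq (rnorm G x v) 0.
  by rewrite (rnorm_eq0 v0) D0 !rnorm0 mulr0.
have vp : 0 < rnorm G x v by rewrite lt_neqAle eq_sym v0 rnorm_ge0.
rewrite -ler_pdivrMr // -lee_fin fineK ?dnorm_fin //.
apply: ereal_sup_ubound; exists ((rnorm G x v)^-1 *: v).
  by split; [rewrite memvZ|rewrite rnormZ ger0_norm ?invr_ge0 ?rnorm_ge0 // mulVf].
by rewrite D_scale rnormZ ger0_norm ?invr_ge0 ?rnorm_ge0 // mulrC.
Qed.

(** The product of W along the orbit of x under f, cut into the steps listed in
    s: the factor of a step r starting at y is W r y. *)
Fixpoint orbit_prod (W : nat -> M -> R) (f : M -> M) x (s : seq nat) : R :=
  if s is r :: s' then W r x * orbit_prod W f (iter r f x) s' else 1.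

Lemma orbit_prod_ge0 (W : nat -> M -> R) f x s :
  (forall i y, 0 <= W i y) -> 0 <= orbit_prod W f x s.
Proof.
by move=> W0; elim: s x => [|r s IH] x //=; rewrite mulr_ge0.
Qed.

Lemma orbit_prodZ (a : R) (W : nat -> M -> R) f x s :
  orbit_prod (fun i y => a * W i y) f x s = a ^+ size s * orbit_prod W f x s.
Proof.
elim: s x => [|r s IH] x /=; first by rewrite mulr1.
by rewrite IH exprS; ring.
Qed.

Section Contraction.
Variables (X : set M) (E : M -> {vspace vec}) (th : disc_family M).
Hypothesis cX : compact X.
Hypothesis thX : tangent_disc_family X E th.
Hypothesis dimX : forall x0, X x0 ->
  \forall y \near within X (nbhs x0), \dim (E y) = \dim (E x0).
Variable g : M -> M.
Hypothesis Cg : C1map g.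
Hypothesis Dg_inj : forall n y v, D (iter n g) y v = 0 -> v = 0.
Hypothesis gX : forall y, X y -> X (g y).

(** The disc of size e at y contains p, with coordinates u. *)
Definition disc_coord e y (u : 'rV[R]_(\dim (E y))) p :=
  @eball R (\dim (E y)) e u /\ th y u = p.

Lemma eball_mono m (e e' : R) u : e <= e' -> @eball R m e u -> @eball R m e' u.
Proof. by move=> ee /= h; apply: lt_le_trans ee. Qed.

Lemma disc_coord_inj e y u v p : X y -> e <= 1 ->
  disc_coord e u p -> disc_coord (y := y) e v p -> u = v.
Proof.
move=> Xy e1 [hu <-] [hv]; have [[_ _ inj _] _ _] := thX.1 y Xy => /inj -> //.
  by rewrite inE; exact: eball_mono hv.
by rewrite inE; exact: eball_mono hu.
Qed.

Lemma iter_invariant n y : X y -> X (iter n g y).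
Proof. by elim: n => //= n IH /IH; exact: gX. Qed.

(** Composition of the one-step estimates.  The intermediate points have disc
    coordinates because the orbits of p and q are assumed to stay in the discs;
    injectivity of the discs makes the coordinates at the two ends the given
    ones. *)
Lemma orbit_estimate (W : nat -> M -> R) (e : R) (Q : pred nat) : e <= 1 ->
  (forall i y, 0 <= W i y) ->
  (forall i y (u v : 'rV[R]_(\dim (E y))) (u' v' : 'rV[R]_(\dim (E (iter i g y)))),
     Q i -> X y -> disc_coord e u (th y u) -> disc_coord e v (th y v) ->
     disc_coord e u' (iter i g (th y u)) -> disc_coord e v' (iter i g (th y v)) ->
     disc_norm G th (iter i g y) (u' - v') <= W i y * disc_norm G th y (u - v)) ->
  forall s, all Q s -> forall x y' p q (u v : 'rV[R]_(\dim (E x)))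
    (u' v' : 'rV[R]_(\dim (E y'))), X x -> y' = iter (sumn s) g x ->
  (forall j, (j <= sumn s)%N -> disc E th e (iter j g x) (iter j g p)) ->
  (forall j, (j <= sumn s)%N -> disc E th e (iter j g x) (iter j g q)) ->
  disc_coord e u p -> disc_coord e v q ->
  disc_coord e u' (iter (sumn s) g p) -> disc_coord e v' (iter (sumn s) g q) ->
  disc_norm G th y' (u' - v') <= orbit_prod W g x s * disc_norm G th x (u - v).
Proof.
move=> e1 W0 step; elim=> [_|r s IH /= /andP[Qr Qs]] x y' p q u v u' v' Xx y'E Hp Hq cu cv cu' cv'.
  rewrite /= in y'E cu' cv'; subst y'.
  by rewrite (disc_coord_inj Xx e1 cu' cu) (disc_coord_inj Xx e1 cv' cv) mul1r.
have Ep z : iter (r + sumn s) g z = iter (sumn s) g (iter r g z).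
  by rewrite addnC iterD.
have [w hw ew] : disc E th e (iter r g x) (iter r g p) by apply: Hp; exact: leq_addr.
have [t ht et] : disc E th e (iter r g x) (iter r g q) by apply: Hq; exact: leq_addr.
have := IH Qs (iter r g x) y' (iter r g p) (iter r g q) w t u' v'.
rewrite -!Ep => IH'.
apply: le_trans (IH' _ y'E _ _ _ _ cu' cv') _.
- exact: iter_invariant.
- by move=> j js; rewrite -!iterD addnC; apply: Hp; rewrite leq_add2l.
- by move=> j js; rewrite -!iterD addnC; apply: Hq; rewrite leq_add2l.
- by split.
- by split.
rewrite (mulrC (W r x)) -[leRHS]mulrA ler_wpM2l ?orbit_prod_ge0 //.
have [hu pu] := cu; have [hv pv] := cv.
by apply: step => //; split; rewrite ?pu ?pv.
Qed.

(** The form in which conditions (a) and (b) are used: the steps have bounded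
    length, so that finitely many maps have to be linearized, and there are at
    most 2n of them, so that a factor a per step costs at most a^(2n).  A product
    of norms is bounded instead of a sum of logarithms, since the norms vanish
    when E is zero. *)
Definition contracts_after (K N : nat) (zeta : R) x : Prop :=
  forall n, (N <= n)%N -> exists s, [/\ all (leq^~ K) s, sumn s = n,
    (size s <= 2 * n)%N &
    orbit_prod (fun r y => fine (dnorm G g r E y)) g x s <= expR (- zeta * n%:R)].

(** The finitely many maps g^i with i <= K share the same disc size. *)
Lemma steps_uniform (K : nat) (a : R) : 1 < a -> exists2 r : R, 0 < r &
  forall i y (u v : 'rV[R]_(\dim (E y))) (u' v' : 'rV[R]_(\dim (E (iter i g y)))),
    (i <= K)%N -> X y -> `|u| <= r -> `|v| <= r -> `|u'| <= r -> `|v'| <= r ->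
    iter i g (th y u) = th (iter i g y) u' ->
    iter i g (th y v) = th (iter i g y) v' ->
    disc_norm G th (iter i g y) (u' - v') <=
      a * fine (dnorm G g i E y) * disc_norm G th y (u - v) /\
    disc_norm G th (iter i g y) (u' - v') <= r^-1 * disc_norm G th y (u - v).
Proof.
move=> a1.
have H i : exists2 r : R, 0 < r & forall y (u v : 'rV[R]_(\dim (E y)))
    (u' v' : 'rV[R]_(\dim (E (iter i g y)))),
    X y -> `|u| <= r -> `|v| <= r -> `|u'| <= r -> `|v'| <= r ->
    iter i g (th y u) = th (iter i g y) u' ->
    iter i g (th y v) = th (iter i g y) v' ->
    disc_norm G th (iter i g y) (u' - v') <=
      a * fine (dnorm G g i E y) * disc_norm G th y (u - v) /\
    disc_norm G th (iter i g y) (u' - v') <= r^-1 * disc_norm G th y (u - v).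
  have [r r0 Hr] := disc_step_uniform G cX thX dimX (C1map_iter i Cg) (@Dg_inj i)
    (@iter_invariant i) a1.
  exists r => // y u v u' v' Xy hu hv hu' hv' eu ev.
  have [k1 k2] := Hr y Xy _ _ u v u' v' erefl erefl hu hv hu' hv' eu ev.
  split => //; apply: le_trans k1 _; rewrite -mulrA ler_wpM2l ?(ltW (lt_trans ltr01 a1)) //.
  by apply: dnorm_bound; exact: (disc_tangent_in thX).
elim: K => [|K [r r0 IH]].
  have [r r0 Hr] := H 0%N; exists r => // i y u v u' v'; rewrite leqn0 => /eqP i0.
  by subst i; exact: Hr.
have [r' r'0 Hr'] := H K.+1.
pose rho := Num.min r r'.
have rho0 : 0 < rho by rewrite lt_min r0.
have l1 : rho <= r by rewrite ge_min lexx.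
have l2 : rho <= r' by rewrite ge_min lexx orbT.
have mono r1 (n1 n2 : R) : rho <= r1 -> 0 <= n2 -> n1 <= r1^-1 * n2 -> n1 <= rho^-1 * n2.
  move=> h h2 h3; apply: le_trans h3 _; rewrite ler_wpM2r // lef_pV2 ?posrE //.
  exact: lt_le_trans h.
exists rho => // i y u v u' v'; rewrite leq_eqVlt => /orP[/eqP iE|].
  subst i => Xy hu hv hu' hv' eu ev.
  have [k1 k2] := Hr' y u v u' v' Xy (le_trans hu l2) (le_trans hv l2)
    (le_trans hu' l2) (le_trans hv' l2) eu ev.
  by split => //; apply: mono k2; rewrite ?disc_norm_ge0.
rewrite ltnS => iK Xy hu hv hu' hv' eu ev.
have [k1 k2] := IH i y u v u' v' iK Xy (le_trans hu l1) (le_trans hv l1)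
    (le_trans hu' l1) (le_trans hv' l1) eu ev.
by split => //; apply: mono k2; rewrite ?disc_norm_ge0.
Qed.

Lemma disc_mono (e e' : R) y p : e <= e' -> disc E th e y p -> disc E th e' y p.
Proof. by move=> ee [u hu <-]; exists u => //; exact: eball_mono hu. Qed.

Lemma disc_self (e : R) y : 0 < e -> X y -> disc E th e y y.
Proof.
move=> e0 Xy; exists 0; last exact: (disc_center thX Xy erefl).
exact: eball0.
Qed.

Lemma dim_le (U : {vspace vec}) : (\dim U <= d)%N.
Proof. by have := dimvS (subvf U); rewrite dimvf /dim /= mul1n. Qed.

Lemma orbit_prod_cst (B : R) x n : orbit_prod (fun _ _ => B) g x (nseq n 1%N) = B ^+ n.
Proof. by elim: n x => [|n IH] x //=; rewrite IH exprS. Qed.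

(** For n >= N the decomposition into steps gives the factor
    a^(2n) exp(- zeta n) = exp(- zetabar n); for n < N the crude bound for single
    steps gives a constant, which is put into C. *)
Lemma disc_orbit_estimate (K N : nat) (zeta zetabar : R) (L : set M) :
  (0 < K)%N -> 0 < zetabar < zeta -> L `<=` X ->
  (forall x, L x -> contracts_after K N zeta x) ->
  exists rho C : R, [/\ 0 < rho, rho < 1, 1 <= C &
    (forall y, X y -> forall (u v : 'rV[R]_(\dim (E y))),
      @eball R (\dim (E y)) rho u -> @eball R (\dim (E y)) rho v ->
    [/\ (rdist G (th y u) (th y v) <= (rho^-1 * disc_norm G th y (u - v))%:E)%E,
        ((disc_norm G th y (u - v))%:E <= (rho^-1)%:E * rdist G (th y u) (th y v))%E,
        `|u - v| <= rho^-1 * disc_norm G th y (u - v) &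
        disc_norm G th y (u - v) <= rho^-1 * `|u - v|]) /\
    forall n x y' p q (u v : 'rV[R]_(\dim (E x))) (u' v' : 'rV[R]_(\dim (E y'))),
      L x -> y' = iter n g x ->
      (forall j, (j <= n)%N -> disc E th rho (iter j g x) (iter j g p)) ->
      (forall j, (j <= n)%N -> disc E th rho (iter j g x) (iter j g q)) ->
      disc_coord rho u p -> disc_coord rho v q ->
      disc_coord rho u' (iter n g p) -> disc_coord rho v' (iter n g q) ->
      disc_norm G th y' (u' - v') <= C * expR (- zetabar * n%:R) * disc_norm G th x (u - v)].
Proof.
move=> K0 /andP[zb0 zbz] LX HL.
pose a := expR ((zeta - zetabar) / 2).
have a1 : 1 < a by rewrite expR_gt1 divr_gt0 // subr_gt0.
have [r1 r10 S1] := steps_uniform K a1.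
have [r2 r20 S2] := disc_metric_uniform G cX thX dimX.
pose rho := Num.min (Num.min r1 r2) 2^-1.
have rho0 : 0 < rho by rewrite !lt_min r10 r20 /= invr_gt0.
have rho1 : rho < 1 by rewrite gt_min; apply/orP; right; rewrite invf_lt1 // ltr1n.
have l1 : rho <= r1 by rewrite !ge_min lexx.
have l2 : rho <= r2 by rewrite !ge_min lexx orbT.
have i1 : r1^-1 <= rho^-1 by rewrite lef_pV2 ?posrE.
have i2 : r2^-1 <= rho^-1 by rewrite lef_pV2 ?posrE.
have B1 : 1 <= rho^-1 by rewrite invf_ge1 // ltW.
have B0 : 0 < rho^-1 by rewrite invr_gt0.
have en1 m (u : 'rV[R]_m) : @eball R m rho u -> `|u| <= r1.
  by move=> /eball_norm/ltW h; exact: le_trans l1.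
have en2 m (u : 'rV[R]_m) : @eball R m rho u -> `|u| <= r2.
  by move=> /eball_norm/ltW h; exact: le_trans l2.
pose C := rho^-1 ^+ N * expR (zetabar * N%:R).
have C1 : 1 <= C.
  rewrite -[leLHS]mul1r ler_pM // ?exprn_ege1 // -expR0 ler_expR mulr_ge0 // ltW //.
exists rho, C; split => //; split.
  move=> y Xy u v /en2 hu /en2 hv.
  have [k1 k2 k3 k4] := S2 y Xy _ u v erefl hu hv.
  have n0 := disc_norm_ge0 G th y (u - v).
  split.
  - by apply: le_trans k1 _; rewrite lee_fin ler_wpM2r.
  - by apply: le_trans k2 _; apply: lee_wpmul2r; [exact: rdist_ge0|rewrite lee_fin].
  - by apply: le_trans k3 _; rewrite ler_wpM2r.
  - by apply: le_trans k4 _; rewrite ler_wpM2r.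
move=> n x y' p q u v u' v' Lx y'E Hp Hq cu cv cu' cv'.
have n0 := disc_norm_ge0 G th x (u - v).
have [nN|Nn] := ltnP n N.
  (* Fewer than N iterates: n steps of length 1, with the crude bound. *)
  pose W (i : nat) (y : M) : R := rho^-1.
  have W0 i y : 0 <= W i y by exact: ltW.
  have step i y (w t : 'rV[R]_(\dim (E y))) (w' t' : 'rV[R]_(\dim (E (iter i g y)))) :
     pred1 1%N i -> X y -> disc_coord rho w (th y w) -> disc_coord rho t (th y t) ->
     disc_coord rho w' (iter i g (th y w)) -> disc_coord rho t' (iter i g (th y t)) ->
     disc_norm G th (iter i g y) (w' - t') <= W i y * disc_norm G th y (w - t).
    move=> /eqP i1' Xy [/en1 hw _] [/en1 ht _] [/en1 hw' ew] [/en1 ht' et].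
    have iK : (i <= K)%N by rewrite i1'.
    have [_ k] := S1 i y w t w' t' iK Xy hw ht hw' ht' (esym ew) (esym et).
    by apply: le_trans k _; rewrite ler_wpM2r ?disc_norm_ge0.
  have aQ : all (pred1 1%N) (nseq n 1%N) by exact: all_pred1_nseq.
  have sn : sumn (nseq n 1%N) = n by rewrite sumn_nseq mul1n.
  have := orbit_estimate (ltW rho1) W0 step aQ (p := p) (q := q) (LX _ Lx).
  rewrite sn orbit_prod_cst => H.
  apply: le_trans (H _ u v u' v' y'E Hp Hq cu cv cu' cv') _.
  rewrite ler_wpM2r //; apply: (@le_trans _ _ (rho^-1 ^+ N * 1)).
    by rewrite mulr1 ler_weXn2l // ltnW.
  rewrite /C -mulrA -expRD ler_pM2l ?exprn_gt0 // -[leLHS]expR0 ler_expR mulNr -mulrBr.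
  by rewrite mulr_ge0 ?(ltW zb0) // subr_ge0 ler_nat ltnW.
have [s [aK sn ss sp]] := HL x Lx n Nn.
pose W i y := a * fine (dnorm G g i E y).
have W0 i y : 0 <= W i y.
  by rewrite mulr_ge0 ?expR_ge0 // fine_ge0 ?dnorm_nonneg.
have step i y (w t : 'rV[R]_(\dim (E y))) (w' t' : 'rV[R]_(\dim (E (iter i g y)))) :
   (i <= K)%N -> X y -> disc_coord rho w (th y w) -> disc_coord rho t (th y t) ->
   disc_coord rho w' (iter i g (th y w)) -> disc_coord rho t' (iter i g (th y t)) ->
   disc_norm G th (iter i g y) (w' - t') <= W i y * disc_norm G th y (w - t).
  move=> iK Xy [/en1 hw _] [/en1 ht _] [/en1 hw' ew] [/en1 ht' et].
  by have [k _] := S1 i y w t w' t' iK Xy hw ht hw' ht' (esym ew) (esym et).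
have := orbit_estimate (Q := leq^~ K) (ltW rho1) W0 step aK (p := p) (q := q) (LX _ Lx).
rewrite sn orbit_prodZ => H.
apply: le_trans (H _ u v u' v' y'E Hp Hq cu cv cu' cv') _.
rewrite ler_wpM2r //; apply: (@le_trans _ _ (1 * expR (- zetabar * n%:R))); last first.
  by rewrite ler_wpM2r ?expR_ge0.
rewrite mul1r; apply: (@le_trans _ _ (a ^+ (2 * n) * expR (- zeta * n%:R))).
  apply: ler_pM => //.
  - by rewrite exprn_ge0 // expR_ge0.
  - by apply: orbit_prod_ge0 => i y; rewrite fine_ge0 ?dnorm_nonneg.
  - by rewrite ler_weXn2l // ltW.
rewrite /a -expRM_natl -expRD ler_expR natrM le_eqVlt; apply/orP; left; apply/eqP.
by field.
Qed.

(** The quotient in the theorem is 0 when the disc has diameter 0, as happens when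
    E is zero. *)
Lemma div_diam_le (D0 D1 : \bar R) (c : R) : 0 <= c -> (0 <= D0)%E -> (0 <= D1)%E ->
  (D1 <= c%:E * D0)%E -> (D1 / D0 <= c%:E)%E.
Proof.
move=> c0 d0 d1; case: D0 d0 => [r| |] //.
  rewrite lee_fin le_eqVlt => /orP[/eqP <-|r0 h].
    rewrite mule0 => h; have -> : D1 = 0%E by apply: le_anti; rewrite h d1.
    by rewrite mul0e lee_fin.
  by rewrite inver gt_eqF // lee_pdivrMr.
by move=> _ _; rewrite invey mule0 lee_fin.
Qed.

(** A disc of size eps at x is mapped by g^n into the disc of size e at g^n x,
    by induction on n: local invariance places the image of the next iterate in
    the disc of size rho, where [disc_orbit_estimate], applied to the orbits of p
    and x, shows that its coordinates are in fact less than e.  Once all orbits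
    are known to stay in the discs, the same estimate applied to two points p
    and q of the disc at x contracts their distance. *)
Theorem disc_contraction (K N : nat) (zeta zetabar : R) (L : set M) :
  (0 < K)%N -> 0 < zetabar < zeta -> L `<=` X ->
  (forall x, L x -> contracts_after K N zeta x) ->
  (forall e1 : R, 0 < e1 < 1 -> exists2 e2 : R, 0 < e2 < 1 &
     forall x, X x -> g @` disc E th e2 x `<=` disc E th e1 (g x)) ->
  exists e0 C : R, [/\ 0 < e0, e0 <= 1, 1 <= C &
    forall e, 0 < e <= e0 -> forall x, L x ->
    diam G (iter n g @` disc E th e x) @[n --> \oo] --> 0%E /\
    forall n, (diam G (iter n g @` disc E th e x) / diam G (disc E th e x)
      <= (C * expR (- zetabar * n%:R))%:E)%E].
Proof.
move=> K0 zz LX HL Hinv; have /andP[zb0 _] := zz.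
have [rho [C [rho0 rho1 C1 [Hm He]]]] := disc_orbit_estimate K0 zz LX HL.
have C0 : 0 < C by apply: lt_le_trans C1.
have B0 : 0 < rho^-1 by rewrite invr_gt0.
have [e2 /andP[e20 e21] inv] : exists2 e2 : R, 0 < e2 < 1 &
     forall x, X x -> g @` disc E th e2 x `<=` disc E th rho (g x).
  by apply: Hinv; rewrite rho0.
pose e := Num.min e2 rho.
have e0 : 0 < e by rewrite lt_min e20.
have ee2 : e <= e2 by rewrite ge_min lexx.
have er : e <= rho by rewrite ge_min lexx orbT.
(* delta bounds the norm at the center of the coordinates of the iterates: it
     implies that these coordinates are in the Euclidean ball of radius e, the
     dimension of which is at most d. *)
pose delta := rho * (e / d.+1%:R) / 2.
have delta0 : 0 < delta by rewrite !divr_gt0 ?mulr_gt0 ?divr_gt0.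
pose eps := Num.min e (delta / (C * rho^-1)).
have eps0 : 0 < eps by rewrite lt_min e0 /= divr_gt0 // mulr_gt0.
have epse : eps <= e by rewrite ge_min lexx.
have epsr : eps <= rho by exact: le_trans er.
have epsd : C * (rho^-1 * eps) <= delta.
  by rewrite mulrA mulrC -ler_pdivlMr ?mulr_gt0 // ge_min lexx orbT.
have ex1 n : expR (- zetabar * n%:R) <= 1.
  by rewrite -[leRHS]expR0 ler_expR mulNr oppr_le0 mulr_ge0 // ltW.
have contain x p : L x -> disc E th eps x p ->
    forall n j, (j <= n)%N -> disc E th e (iter j g x) (iter j g p).
  move=> Lx Dp; elim=> [|n IH] j.
    by rewrite leqn0 => /eqP ->; exact: disc_mono Dp.
  rewrite leq_eqVlt => /orP[/eqP ->|]; last exact: IH.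
  have Xx := LX _ Lx.
  have Hr i : (i <= n.+1)%N -> disc E th rho (iter i g x) (iter i g p).
    rewrite leq_eqVlt => /orP[/eqP ->|ij]; last exact: disc_mono (IH i ij).
    rewrite /=; apply: inv; first exact: iter_invariant.
    by exists (iter n g p) => //; apply: disc_mono (IH n (leqnn n)).
  have Hx i : (i <= n.+1)%N -> disc E th rho (iter i g x) (iter i g x).
    by move=> _; apply: disc_self => //; exact: iter_invariant.
  have [u hu pu] := Dp.
  have [u' hu' pu'] := Hr _ (leqnn _).
  have cu : disc_coord rho u p by split => //; exact: eball_mono hu.
  have cu' : disc_coord rho u' (iter n.+1 g p) by split.
  have c0 y : X y -> @disc_coord rho y 0 y.
    by move=> Xy; split; [exact: eball0|exact: (disc_center thX Xy erefl)].
  have := He n.+1 x _ p x u 0 u' 0 Lx erefl Hr Hx cu (c0 _ Xx) cu' (c0 _ (iter_invariant _ Xx)).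
  rewrite !subr0 => k.
  exists u' => //; apply: norm_eball => //.
  have [_ _ k3 _] := Hm _ (iter_invariant n.+1 Xx) u' 0 hu' (eball0 _ rho0).
  have [_ _ _ k4] := Hm _ Xx u 0 cu.1 (eball0 _ rho0).
  rewrite !subr0 in k3 k4.
  have nu := ltW (eball_norm hu).
  have k5 : disc_norm G th (iter n.+1 g x) u' <= delta.
    apply: le_trans k _; apply: le_trans epsd; rewrite -mulrA ler_pM2l //.
    apply: (@le_trans _ _ (1 * disc_norm G th x u)); first by rewrite ler_wpM2r ?disc_norm_ge0.
    by rewrite mul1r; apply: le_trans k4 _; rewrite ler_pM2l.
  apply: le_lt_trans k3 _; apply: (@le_lt_trans _ _ (rho^-1 * delta)).
    by rewrite ler_pM2l.
  apply: (@lt_le_trans _ _ (e / d.+1%:R)).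
    rewrite /delta -!mulrA mulKf ?gt_eqF // mulrA.
    by rewrite ltr_pdivrMr // ltr_pMr ?ltr1n // divr_gt0.
  by rewrite ler_pM2l // lef_pV2 ?posrE // ler_nat ltnS dim_le.
have rdist_orbit x p q n : L x -> disc E th eps x p -> disc E th eps x q ->
    (rdist G (iter n g p) (iter n g q) <=
      (rho^-1 * C * rho^-1 * expR (- zetabar * n%:R))%:E * rdist G p q)%E.
  move=> Lx Dp Dq; have Xx := LX _ Lx.
  have Hp i : (i <= n)%N -> disc E th rho (iter i g x) (iter i g p).
    by move=> ij; apply: disc_mono (contain x p Lx Dp n i ij).
  have Hq i : (i <= n)%N -> disc E th rho (iter i g x) (iter i g q).
    by move=> ij; apply: disc_mono (contain x q Lx Dq n i ij).
  have [u hu pu] := Hp 0%N (leq0n n); have [v hv qv] := Hq 0%N (leq0n n).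
  have [u' hu' pu'] := Hp n (leqnn n); have [v' hv' qv'] := Hq n (leqnn n).
  rewrite /= in u hu pu v hv qv.
  have k := He n x _ p q u v u' v' Lx erefl Hp Hq (conj hu pu) (conj hv qv)
    (conj hu' pu') (conj hv' qv').
  have [k1 _ _ _] := Hm _ (iter_invariant n Xx) u' v' hu' hv'.
  have [_ k2 _ _] := Hm _ Xx u v hu hv.
  rewrite pu' qv' in k1; rewrite pu qv in k2.
  apply: le_trans k1 _.
  apply: (@le_trans _ _ ((rho^-1 * (C * expR (- zetabar * n%:R)))%:E *
     (disc_norm G th x (u - v))%:E)%E).
    by rewrite -EFinM lee_fin -mulrA ler_pM2l.
  apply: (@le_trans _ _ ((rho^-1 * (C * expR (- zetabar * n%:R)))%:E *
     ((rho^-1)%:E * rdist G p q))%E).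
    by apply: lee_wpmul2l => //; rewrite lee_fin !mulr_ge0 ?expR_ge0 // ltW.
  rewrite muleA -EFinM le_eqVlt; apply/orP; left; apply/eqP; congr (_%:E * _)%E; ring.
pose C2 := rho^-1 * C * rho^-1.
have C21 : 1 <= C2.
  have B1 : 1 <= rho^-1 by rewrite invf_ge1 // ltW.
  by rewrite -[leLHS]mulr1 ler_pM // -[leLHS]mulr1 ler_pM.
have C20 : 0 < C2 by apply: lt_le_trans C21.
exists eps, C2; split => //; first exact: le_trans epsr (ltW rho1).
move=> ep /andP[ep0 epe] x Lx; have Xx := LX _ Lx.
have De p : disc E th ep x p -> disc E th eps x p by exact: disc_mono.
have sub0 (A : set M) y : A y -> (0 <= diam G A)%E.
  move=> Ay; apply: (@le_trans _ _ (rdist G y y)); first exact: rdist_ge0.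
  by apply: ereal_sup_ubound; exists (y, y).
have Dx : disc E th ep x x by exact: disc_self.
have d00 : (0 <= diam G (disc E th ep x))%E by exact: sub0 Dx.
have dn0 n : (0 <= diam G (iter n g @` disc E th ep x))%E.
  by apply: (sub0 _ (iter n g x)); exists x.
have key n : (diam G (iter n g @` disc E th ep x) <=
   (C2 * expR (- zetabar * n%:R))%:E * diam G (disc E th ep x))%E.
  apply: ge_ereal_sup => _ [[_ _] /= [[p Dp <-] [q Dq <-]] <-].
  apply: le_trans (rdist_orbit x p q n Lx (De p Dp) (De q Dq)) _.
  apply: lee_wpmul2l; first by rewrite lee_fin mulr_ge0 ?expR_ge0 // ltW.
  by apply: ereal_sup_ubound; exists (p, q).
(* The initial diameter is finite, which the convergence to 0 requires. *)
have fin0 : (diam G (disc E th ep x) <= (rho^-1 * (rho^-1 * 2))%:E)%E.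
  apply: ge_ereal_sup => _ [[_ _] /= [[u hu <-] [v hv <-]] <-].
  have er' : ep <= rho by exact: le_trans epsr.
  have hu' := eball_mono er' hu; have hv' := eball_mono er' hv.
  have [k1 _ _ k4] := Hm _ Xx u v hu' hv'.
  apply: le_trans k1 _; rewrite lee_fin ler_pM2l //.
  apply: le_trans k4 _; rewrite ler_pM2l //.
  apply: le_trans (ler_normB _ _) _.
  have := eball_norm hu'; have := eball_norm hv'; lra.
split; last first.
  by move=> n; apply: div_diam_le => //; rewrite mulr_ge0 ?expR_ge0 // ltW.
pose A := C2 * (rho^-1 * (rho^-1 * 2)).
apply: (@squeeze_cvge _ _ _ _ (cst 0%E) _ (fun n => (A * expR (- zetabar) ^+ n)%:E)).
- apply: nearW => n; rewrite dn0 /=; apply: le_trans (key n) _.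
  apply: (@le_trans _ _ ((C2 * expR (- zetabar * n%:R))%:E * (rho^-1 * (rho^-1 * 2))%:E)%E).
    by apply: lee_wpmul2l => //; rewrite lee_fin mulr_ge0 ?expR_ge0 // ltW.
  rewrite -EFinM lee_fin /A mulrC -expRM_natl (mulrC n%:R).
  by rewrite le_eqVlt; apply/orP; left; apply/eqP; ring.
- exact: cvg_cst.
- apply: cvg_EFin; first exact: nearW.
  rewrite -[X in _ --> X](mulr0 A); apply: cvgMr.
  by apply: cvg_expr; rewrite ger0_norm ?expR_ge0 // expR_lt1 oppr_lt0.
Qed.

End Contraction.
End Dynamics.

(** * The blocks and their center discs *)

Section Blocks.
Variables (R : realType) (d : nat) (M : manifold R d) (G : riemannian M).
Local Notation vec := 'rV[R]_d.
Implicit Types (x y z p q : M) (E F : M -> {vspace vec}).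

Lemma tcoord_self x v : tcoord x x v = v.
Proof. by have := tangent_param_id x v; rewrite /tangent chartK //; exact: dom_center. Qed.

(** Lower semicontinuity: the image of E y by the tangent map of a change of
    charts has dimension \dim (E x0). *)
Lemma subbundle_dim_ge (X : set M) E x0 : continuous_subbundle X E -> X x0 ->
  \forall y \near within X (nbhs x0), (\dim (E x0) <= \dim (E y))%N.
Proof.
move=> H X0; have [m [b [_ Hb]]] := H x0 X0.
have [_ B0] : dom x0 x0 /\ basis_of (linfun (tcoord x0 x0) @: E x0)%VS (b x0).
  by have := Hb; rewrite near_withinE => /nbhs_singleton; exact.
have E1 : linfun (tcoord x0 x0) = \1%VF.
  by apply/lfunP => v; rewrite id_lfunE -[RHS](tcoord_self x0) /tcoord lfunE.
have mE : \dim (E x0) = m by rewrite -(size_basis B0) E1 lim1g.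
apply: filterS Hb => y [_ /size_basis By]; rewrite mE -By.
by rewrite -(limg_ker_dim (linfun (tcoord x0 y)) (E y)) leq_addl.
Qed.

Lemma splitting_dim E F x : splitting_at E F x -> (\dim (E x) + \dim (F x) = d)%N.
Proof.
move=> [sEF iEF]; rewrite -(dimv_disjoint_sum iEF) sEF dimvf /dim /=.
exact: mul1n.
Qed.

Lemma splitting_dim_locally_constant (X : set M) E F x0 :
  (forall x, X x -> splitting_at E F x) ->
  continuous_subbundle X E -> continuous_subbundle X F -> X x0 ->
  \forall y \near within X (nbhs x0), \dim (E y) = \dim (E x0) /\ \dim (F y) = \dim (F x0).
Proof.
move=> sp cE cF X0.
have HX : \forall y \near within X (nbhs x0), X y by exact: withinT.
have sx := splitting_dim (sp _ X0).
apply: filterS3 HX (subbundle_dim_ge cE X0) (subbundle_dim_ge cF X0) => y Xy hE hF.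
have sy := splitting_dim (sp _ Xy).
by split; lia.
Qed.

Lemma closure_invariant (T : topologicalType) (S : set T) (f : T -> T) (y : T) :
  continuous f -> f @` S `<=` S -> closure S y -> closure S (f y).
Proof.
move=> cf fS Sy B nB; have [s [Ss Bs]] := Sy _ (cf y B nB).
by exists (f s); split => //; apply: fS; exists s.
Qed.

Section Orbits.
Variables (f finv : M -> M).
Hypotheses (fK : cancel f finv) (finvK : cancel finv f).

Lemma iterz_f l x : exists l', f (iterz f finv l x) = iterz f finv l' x.
Proof.
case: l => [n|[|n]]; first by exists (Posz n.+1).
  by exists (Posz 0); rewrite /= finvK.
by exists (Negz n); rewrite /= finvK.
Qed.

Lemma iterz_finv l x : exists l', finv (iterz f finv l x) = iterz f finv l' x.
Proof.
case: l => [[|n]|n]; last by exists (Negz n.+1).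
  by exists (Negz 0).
by exists (Posz n); rewrite /= fK.
Qed.

Lemma iterzN n x : iterz f finv (- n%:Z) x = iter n finv x.
Proof. by case: n => [|n] //; rewrite -NegzE. Qed.

Lemma iterK n : cancel (iter n f) (iter n finv).
Proof.
by elim: n => // n IH x; rewrite [LHS]iterSr iterS fK IH.
Qed.

End Orbits.

Section Delta.
Variables (f finv : M -> M) (K k : nat) (zeta : R).
Hypotheses (fK : cancel f finv) (finvK : cancel finv f).
Hypotheses (Cf : C1map f) (Cfinv : C1map finv).
Local Notation X := (Delta G f finv K k zeta).

Lemma Delta_f y : X y -> X (f y).
Proof.
apply: closure_invariant; first exact: C1map_continuous.
move=> _ [_ [l _ [x Lx <-]] <-]; have [l' ->] := iterz_f finvK l x.
by exists l' => //; exists x.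
Qed.

Lemma Delta_finv y : X y -> X (finv y).
Proof.
apply: closure_invariant; first exact: C1map_continuous.
move=> _ [_ [l _ [x Lx <-]] <-]; have [l' ->] := iterz_finv fK l x.
by exists l' => //; exists x.
Qed.

Lemma Lambda_Delta : Lambda G f finv K k zeta `<=` X.
Proof.
move=> x Lx; apply: subset_closure; exists (Posz 0) => //; by exists x.
Qed.

End Delta.

Lemma D_iter_inj (g gi : M -> M) n y v : cancel g gi -> C1map g -> C1map gi ->
  D (iter n g) y v = 0 -> v = 0.
Proof.
move=> gK Cg Cgi h.
have E1 : (iter n gi \o iter n g) = id by apply/funext => x; exact: (iterK gK).
have := D_comp y v (C1map_iter n Cgi) (C1map_iter n Cg).
by rewrite E1 D_id h D0.
Qed.

Lemma orbit_prod_nseq (W : nat -> M -> R) g x K l :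
  orbit_prod W g x (nseq l K) = \prod_(0 <= j < l) W K (iter (j * K) g x).
Proof.
elim: l x => [|l IH] x /=; first by rewrite big_geq.
rewrite IH big_nat_recl //; congr (_ * _); apply: eq_bigr => j _.
by rewrite mulSn addnC iterD.
Qed.

Lemma orbit_prod_cat (W : nat -> M -> R) g x s t :
  orbit_prod W g x (s ++ t) = orbit_prod W g x s * orbit_prod W g (iter (sumn s) g x) t.
Proof.
elim: s x => [|r s IH] x /=; first by rewrite mul1r.
by rewrite IH mulrA addnC iterD.
Qed.

(** For the conorms c j only upper bounds are available, in terms of the norms w j
    of the inverse maps, and only while these norms are positive. *)
Lemma sum_lne_le (l : nat) (c : nat -> \bar R) (w : nat -> R) :
  (forall j, (j < l)%N -> 0 < w j /\ (lne (c j) <= (- ln (w j))%:E)%E) ->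
  0 < \prod_(0 <= j < l) w j /\
  (\sum_(0 <= j < l) lne (c j) <= (- ln (\prod_(0 <= j < l) w j))%:E)%E.
Proof.
elim: l => [|l IH] H; first by rewrite !big_geq // ln1 oppr0 ltr01.
have [p0 IH'] := IH (fun j jl => H j (ltnW jl)).
have [w0 cl] := H l (leqnn _).
rewrite !big_nat_recr //= mulr_gt0 //; split => //.
by rewrite lnM ?posrE // opprD EFinD leeD.
Qed.

(** Separates the degenerate case of a vanishing norm, where the contraction
    estimate is trivial and logarithms cannot be used. *)
Lemma prod_gt0_or_eq0 l (w : nat -> R) : (forall j, 0 <= w j) ->
  \prod_(0 <= j < l) w j = 0 \/ forall j, (j < l)%N -> 0 < w j.
Proof.
move=> w0; elim: l => [|l [IH|IH]]; first by right.
  by left; rewrite big_nat_recr //= IH mul0r.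
have [wl|wl] := eqVneq (w l) 0.
  by left; rewrite big_nat_recr //= wl mulr0.
right=> j; rewrite ltnS leq_eqVlt => /orP[/eqP ->|]; last exact: IH.
by rewrite lt_neqAle eq_sym wl w0.
Qed.

(** Conditions (a) and (b) speak of the times l K + r with l >= k and r < K, that
    is of all times n >= k K; they are then cut into l + 1 <= 2n steps. *)
Lemma block_steps K k n : (0 < K)%N -> (0 < k)%N -> (k * K <= n)%N ->
  exists l r, [/\ (k <= l)%N, (r < K)%N, n = (l * K + r)%N & (l.+1 <= 2 * n)%N].
Proof.
move=> K0 k0 kn; exists (n %/ K)%N, (n %% K)%N.
have h1 : (k <= n %/ K)%N by rewrite leq_divRL.
have h2 := divn_eq n K.
split => //; first by rewrite ltn_mod.
have : (n %/ K <= n)%N by exact: leq_div.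
have : (0 < n)%N by apply: leq_trans kn; rewrite muln_gt0 k0.
lia.
Qed.

(** Condition (a) at the time n = l K + r, with a first step r followed by l steps
    of length K. *)
Lemma contracts_forward f finv K k zeta E x : (0 < K)%N -> (0 < k)%N ->
  cond_a G f finv K k zeta E x -> contracts_after G E f K (k * K) zeta x.
Proof.
move=> K0 k0 Ha n kn; have [l [r [kl rK nE n2]]] := block_steps K0 k0 kn.
pose w i y := fine (dnorm G f i E y).
have w0 i y : 0 <= w i y by rewrite /w fine_ge0 // dnorm_nonneg.
have wE i y : dnorm G f i E y = (w i y)%:E by rewrite /w fineK // dnorm_fin.
exists (r :: nseq l K); split.
- by rewrite /= ltnW // all_nseq leqnn orbT.
- by rewrite /= sumn_nseq nE addnC mulnC.
- by rewrite /= size_nseq.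
have n0 : 0 < n%:R :> R by rewrite ltr0n; apply: leq_trans kn; rewrite muln_gt0 k0.
rewrite -/w; clearbody w; rewrite /= orbit_prod_nseq.
have [->|pos] := @prod_gt0_or_eq0 l (fun j => w K (iter (j * K) f (iter r f x))) (fun j => w0 _ _).
  by rewrite mulr0 expR_ge0.
have [->|wr] := eqVneq (w r x) 0; first by rewrite mul0r expR_ge0.
have {}wr : 0 < w r x by rewrite lt_neqAle eq_sym wr w0.
have lnw i y : 0 < w i y -> lne (dnorm G f i E y) = (ln (w i y))%:E.
  by move=> wi; rewrite wE lne_EFin.
have P0 : 0 < \prod_(0 <= j < l) w K (iter (j * K) f (iter r f x)).
  by rewrite big_seq; apply: prodr_gt0 => j; rewrite mem_index_iota => /andP[_]; exact: pos.
have H : (((ln (w r x))%:E + \sum_(0 <= j < l)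
    (ln (w K (iter (j * K) f (iter r f x))))%:E) / (n%:R)%:E <= (- zeta)%:E)%E.
  rewrite nE -(lnw r x wr) (eq_big_nat _ _ (F2 := fun j =>
    lne (dnorm G f K E (iterz f finv (j * K + r)%N%:Z x)))); first exact: Ha.
  by move=> j /andP[_ jl]; rewrite -(lnw _ _ (pos j jl)) -iterD.
move: H; rewrite sumEFin -EFinD inver gt_eqF // lee_pdivrMr // lee_fin => H.
rewrite -(lnK (x := w r x * _)) ?posrE ?mulr_gt0 // ler_expR.
rewrite lnM ?posrE //; apply: le_trans H.
rewrite lerD2l.
have : forall m, (m <= l)%N -> ln (\prod_(0 <= j < m) w K (iter (j * K) f (iter r f x))) =
   \sum_(0 <= j < m) ln (w K (iter (j * K) f (iter r f x))).
  elim=> [|m IH] ml; first by rewrite !big_geq // ln1.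
  have pm : 0 < \prod_(0 <= j < m) w K (iter (j * K) f (iter r f x)).
    rewrite big_seq; apply: prodr_gt0 => j; rewrite mem_index_iota => /andP[_ jm].
    by apply: pos; exact: ltn_trans ml.
  rewrite !big_nat_recr //= lnM ?posrE //; last exact: pos.
  by rewrite IH // ltnW.
by move=> -> //.
Qed.

Lemma invariant_iter (f : M -> M) F z n : C1map f ->
  (forall j, invariant_at f F (iter j f z)) -> forall w, w \in F (iter n f z) ->
  exists2 v, v \in F z & w = D (iter n f) z v.
Proof.
move=> Cf inv; elim: n => [|n IH] w /=.
  by move=> wF; exists w => //; rewrite D_id.
have := inv n; rewrite /invariant_at => <- /memv_imgP[u uF ->].
have [v vF ->] := IH u uF; exists v => //.
rewrite (_ : iter n.+1 f = f \o iter n f) // (D_comp _ _ Cf (C1map_iter n Cf)).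
by rewrite {1}/D /tangent lfunE.
Qed.

(** If w is the norm of Df^(-i) on F(y), the conorm of Df^i on F(f^(-i) y) is at
    most 1 / w, because the image by Df^(-i) of a vector of F(y) is a vector of
    F(f^(-i) y), by invariance. *)
Lemma dnorm_inv_dconorm f finv F i y : cancel f finv -> cancel finv f ->
  C1map f -> C1map finv ->
  (forall j, invariant_at f F (iter j f (iter i finv y))) ->
  (0 < dnorm G finv i F y)%E ->
  (lne (dconorm G f i F (iter i finv y)) <= (- ln (fine (dnorm G finv i F y)))%:E)%E.
Proof.
move=> fK finvK Cf Cfinv inv.
rewrite -{1 2}[dnorm _ _ _ _ _](fineK (dnorm_fin _ _ _ _ _)) lte_fin.
set w := fine _ => w0; set z := iter i finv y.
have fz : iter i f z = y by exact: iterK.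
set c := dconorm _ _ _ _ _.
have c0 : (0 <= c)%E.
  rewrite inve_ge0; apply: (@le_trans _ _ (rnorm G z 0)%:E).
    by rewrite lee_fin rnorm_ge0.
  apply: ereal_sup_ubound; exists 0 => //; split; first exact: mem0v.
  by rewrite D0 rnorm0 ler01.
suff cw : (c <= (w^-1)%:E)%E.
  have -> : (- ln w)%:E = lne (w^-1)%:E by rewrite lne_EFin ?invr_gt0 // lnV.
  rewrite lee_lne ?in_itv /= ?leey ?c0 // andbT.
  by rewrite lee_fin invr_ge0 ltW.
have -> : (w^-1)%:E = (w%:E)^-1%E by rewrite inver gt_eqF.
rewrite /c /dconorm /conorm lee_pV2 ?inE; last 2 first.
- by rewrite -inve_ge0.
- rewrite lee_fin; exact: ltW.
rewrite fineK ?dnorm_fin //; apply: ge_ereal_sup => _ [v [vF v1] <-].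
apply: ereal_sup_ubound; exists (D (iter i finv) y v) => //.
have E2 : (iter i f \o iter i finv) = id by apply/funext => t; exact: (iterK finvK).
have E3 : (iter i finv \o iter i f) = id by apply/funext => t; exact: (iterK fK).
have vE : D (iter i f) z (D (iter i finv) y v) = v.
  by rewrite -(D_comp _ _ (C1map_iter i Cf) (C1map_iter i Cfinv)) E2 D_id.
rewrite /= fz vE; split => //.
move: vF; rewrite -fz => /(invariant_iter Cf inv) [t tF ->].
by rewrite -(D_comp _ _ (C1map_iter i Cfinv) (C1map_iter i Cf)) E3 D_id.
Qed.

(** Condition (b) at the time n = l K + r, read backwards from x: l steps of
    length K of the inverse, followed by a step r. *)
Lemma contracts_backward f finv K k zeta F x : (0 < K)%N -> (0 < k)%N ->
  cancel f finv -> cancel finv f -> C1map f -> C1map finv ->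
  (forall i j, invariant_at f F (iter j f (iter i finv x))) ->
  cond_b G f finv K k zeta F x -> contracts_after G F finv K (k * K) zeta x.
Proof.
move=> K0 k0 fK finvK Cf Cfinv inv Hb n kn.
have [l [r [kl rK nE n2]]] := block_steps K0 k0 kn.
pose w i y := fine (dnorm G finv i F y).
have w0 i y : 0 <= w i y by rewrite /w fine_ge0 // dnorm_nonneg.
have lnw i j : 0 < w i (iter j finv x) ->
    (lne (dconorm G f i F (iter (j + i) finv x)) <= (- ln (w i (iter j finv x)))%:E)%E.
  move=> wi; rewrite addnC iterD; apply: dnorm_inv_dconorm => //.
    by move=> m; rewrite -iterD.
  by rewrite -[dnorm _ _ _ _ _](fineK (dnorm_fin _ _ _ _ _)) lte_fin.
exists (nseq l K ++ [:: r]); split.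
- by rewrite all_cat all_nseq leqnn orbT /= ltnW.
- by rewrite sumn_cat sumn_nseq /= addn0 nE mulnC.
- by rewrite size_cat size_nseq addn1.
have n0 : 0 < n%:R :> R by rewrite ltr0n; apply: leq_trans kn; rewrite muln_gt0 k0.
rewrite -/w; clearbody w.
rewrite orbit_prod_cat sumn_nseq mulnC /= mulr1 orbit_prod_nseq.
have [->|pos] := @prod_gt0_or_eq0 l (fun j => w K (iter (j * K) finv x)) (fun j => w0 _ _).
  by rewrite mul0r expR_ge0.
have [->|wr] := eqVneq (w r (iter (l * K) finv x)) 0; first by rewrite mulr0 expR_ge0.
have {}wr : 0 < w r (iter (l * K) finv x) by rewrite lt_neqAle eq_sym wr w0.
have := Hb l r kl rK; rewrite -nE iterzN big_add1 /=.
rewrite (eq_big_nat _ _ (F2 := fun j => lne (dconorm G f K F (iter (j * K + K) finv x)))); last first.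
  by move=> j _; rewrite iterzN mulSn addnC.
have [P0 SP] := @sum_lne_le l (fun j => dconorm G f K F (iter (j * K + K) finv x))
  (fun j => w K (iter (j * K) finv x)) (fun j jl => conj (pos j jl) (lnw _ _ (pos j jl))).
rewrite inver gt_eqF // lee_pdivlMr // nE => H.
have {}H := le_trans H (leeD (lnw r (l * K)%N wr) SP).
rewrite -EFinM -EFinD lee_fin -nE in H.
rewrite -(lnK (x := _ * w r _)) ?posrE ?mulr_gt0 // ler_expR.
rewrite lnM ?posrE // mulNr -nE; lra.
Qed.

Theorem stable_discs (hM : compact [set: M]) (g gi : M -> M) (K N : nat)
    (zeta zetabar : R) (X L : set M) E (th : disc_family M) :
  (0 < K)%N -> 0 < zetabar < zeta -> cancel g gi -> C1map g -> C1map gi ->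
  closed X -> (forall y, X y -> X (g y)) -> tangent_disc_family X E th ->
  (forall x0, X x0 -> \forall y \near within X (nbhs x0), \dim (E y) = \dim (E x0)) ->
  (forall e1 : R, 0 < e1 < 1 -> exists2 e2 : R, 0 < e2 < 1 &
     forall x, X x -> g @` disc E th e2 x `<=` disc E th e1 (g x)) ->
  L `<=` X -> (forall x, L x -> contracts_after G E g K N zeta x) ->
  exists e0 C : R, [/\ 0 < e0, e0 <= 1, 1 <= C &
    forall e, 0 < e <= e0 -> forall x, L x ->
    diam G (iter n g @` disc E th e x) @[n --> \oo] --> 0%E /\
    forall n, (diam G (iter n g @` disc E th e x) / diam G (disc E th e x)
      <= (C * expR (- zetabar * n%:R))%:E)%E].
Proof.
move=> K0 zz gK Cg Cgi clX gX thX dimX inv LX HL.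
apply: (disc_contraction (subclosed_compact clX hM (subsetT _)) thX dimX Cg _ gX K0 zz LX HL inv).
by move=> n y v; exact: (D_iter_inj gK).
Qed.

End Blocks.

Theorem proposition4p19 (R : realType) (d : nat) (M : manifold R d)
    (G : riemannian M) (hM : compact [set: M])
    (f finv : M -> M) (hf : C1diffeo f finv)
    (K k : nat) (zeta zetabar : R)
    (hK : (1 <= K)%N) (hk : (1 <= k)%N) (hzb : 0 < zetabar)
    (hz : zetabar < zeta)
    (E F : M -> {vspace 'rV[R]_d})
    (hEF : dominated_splitting G f (Delta G f finv K k zeta) E F)
    (hL : forall x, Lambda G f finv K k zeta x ->
            pesin_splitting G f finv K k zeta E F x)
    (thcs thcu : disc_family M)
    (hth : center_manifolds f finv (Delta G f finv K k zeta) E F thcs thcu) :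
  exists eps0 Cbar : R, [/\ 0 < eps0, eps0 <= 1, 1 <= Cbar &
    forall eps : R, 0 < eps <= eps0 ->
    forall x : M, Lambda G f finv K k zeta x ->
    [/\ diam G (iter n f @` disc E thcs eps x) @[n --> \oo] --> 0%E,
        diam G (iter n finv @` disc F thcu eps x) @[n --> \oo] --> 0%E &
        forall n : nat, (1 <= n)%N ->
          (diam G (iter n f @` disc E thcs eps x) /
             diam G (disc E thcs eps x)
           <= (Cbar * expR (- zetabar * n%:R))%:E)%E /\
          (diam G (iter n finv @` disc F thcu eps x) /
             diam G (disc F thcu eps x)
           <= (Cbar * expR (- zetabar * n%:R))%:E)%E]].
Proof.
have [fK finvK Cf Cfinv] := hf.
have [sp cE cF _] := hEF.
have [thE thF inv] := hth.
set X := Delta G f finv K k zeta in hEF sp cE cF thE thF inv.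
have clX : closed X by exact: closed_closure.
have Xf y : X y -> X (f y) by exact: Delta_f.
have Xfinv y : X y -> X (finv y) by exact: Delta_finv.
have LX : Lambda G f finv K k zeta `<=` X by exact: Lambda_Delta.
have sp1 x : X x -> splitting_at E F x by move=> /sp[].
have dimEF x0 (X0 : X x0) := splitting_dim_locally_constant sp1 cE cF X0.
have dimE x0 : X x0 -> \forall y \near within X (nbhs x0), \dim (E y) = \dim (E x0).
  by move=> /dimEF; apply: filterS => y [].
have dimF x0 : X x0 -> \forall y \near within X (nbhs x0), \dim (F y) = \dim (F x0).
  by move=> /dimEF; apply: filterS => y [].
have zz : 0 < zetabar < zeta by rewrite hzb.
have iE (e1 : R) : 0 < e1 < 1 -> exists2 e2 : R, 0 < e2 < 1 &
     forall x, X x -> f @` disc E thcs e2 x `<=` disc E thcs e1 (f x).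
  by move=> /inv[e2 e20 H]; exists e2 => // x Xx; exact: (H x Xx).1.
have iF (e1 : R) : 0 < e1 < 1 -> exists2 e2 : R, 0 < e2 < 1 &
     forall x, X x -> finv @` disc F thcu e2 x `<=` disc F thcu e1 (finv x).
  by move=> /inv[e2 e20 H]; exists e2 => // x Xx; exact: (H x Xx).2.
have cf x : Lambda G f finv K k zeta x -> contracts_after G E f K (k * K) zeta x.
  by move=> /hL [_ ca _ _ _]; exact: (contracts_forward hK hk ca).
have cb x : Lambda G f finv K k zeta x -> contracts_after G F finv K (k * K) zeta x.
  move=> Lx; have [_ _ cb _ _] := hL x Lx.
  apply: (contracts_backward hK hk fK finvK Cf Cfinv _ cb) => i j.
  by have [] := sp _ (iter_invariant Xf j (iter_invariant Xfinv i (LX _ Lx))).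
have [e1 [C1 [e10 e11 C11 H1]]] := stable_discs hM hK zz fK Cf Cfinv clX Xf thE dimE iE LX cf.
have [e2 [C2 [e20 e21 C21 H2]]] := stable_discs hM hK zz finvK Cfinv Cf clX Xfinv thF dimF iF LX cb.
exists (Num.min e1 e2), (Num.max C1 C2); split.
- by rewrite lt_min e10.
- by rewrite ge_min e11.
- by rewrite le_max C11.
move=> e /andP[e0]; rewrite le_min => /andP[l1 l2] x Lx.
have [d1 b1] := H1 e (introT andP (conj e0 l1)) x Lx.
have [d2 b2] := H2 e (introT andP (conj e0 l2)) x Lx.
split => // n _; split.
- apply: le_trans (b1 n) _; rewrite lee_fin ler_wpM2r ?expR_ge0 //.
  by rewrite le_max lexx.
- apply: le_trans (b2 n) _; rewrite lee_fin ler_wpM2r ?expR_ge0 //.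
  by rewrite le_max lexx orbT.
Qed.
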